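(* Let $G$ and $H$ be étale groupoids and let $X$ be a free and proper $G$-$H$-space. Then there is a one-to-one correspondence between $G$-invariant Radon measures $\rho$ on $X$ and Radon measures $\mu$ on $G\backslash X$. Moreover, this correspondence is additive and $H$-equivariant.
   Context: Étale groupoids are locally compact and Hausdorff; measures are positive. A left $G$-space is a locally compact Hausdorff space $X$ with a continuous anchor map $X\to G^{(0)}$ and a continuous action map $(\gamma,x)\mapsto\gamma x$, defined when $s(\gamma)$ is the anchor of $x$, satisfying the usual action axioms; right $H$-spaces are defined similarly. A $G$-$H$-space is a space with a left $G$-action and a right $H$-action that commute (in particular each anchor map is invariant under the other action); it is free and proper if the actions are free and proper. Then $G\backslash X$ is locally compact Hausdorff and carries an induced right $H$-action. A measure $\rho$ on $X$ is $G$-invariant if it is preserved by the partial homeomorphisms of $X$ induced by open bisections of $G$. $H$-equivariance of the correspondence means that it is compatible with the partial homeomorphisms of $X$ and of $G\backslash X$ induced by (open bisections of) $H$: transporting $\rho$ by the action of $H$ on $X$ corresponds to transporting $\mu$ by the induced action of $H$ on $G\backslash X$. *)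

(* Defs.v *)
From HB Require Import structures.
From mathcomp Require Import all_boot all_order all_algebra.
From mathcomp Require Import all_classical all_reals all_analysis.

Set Implicit Arguments.
Unset Strict Implicit.
Unset Printing Implicit Defensive.

Local Open Scope classical_set_scope.
Local Open Scope quotient_scope.
Local Open Scope ring_scope.

Definition local_homeomorphism (S T : topologicalType) (f : S -> T) :=
  forall x : S, exists U : set S,
    [/\ open U, U x, set_inj U f, {within U, continuous f} &
        forall W : set S, open W -> W `<=` U -> open (f @` W)].

(* Products, and below the actions, are total functions; they are meaningful
   only on composable pairs, and no axiom constrains them elsewhere. *)
Record etale_groupoid := EtaleGroupoid {
  arrows :> topologicalType ;
  units : topologicalType ;
  src : arrows -> units ;
  rng : arrows -> units ;
  unit_arrow : units -> arrows ;
  gmul : arrows -> arrows -> arrows ;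
  ginv : arrows -> arrows ;
  src_unit : forall u, src (unit_arrow u) = u ;
  rng_unit : forall u, rng (unit_arrow u) = u ;
  src_gmul : forall g h, src g = rng h -> src (gmul g h) = src h ;
  rng_gmul : forall g h, src g = rng h -> rng (gmul g h) = rng g ;
  gmul_unitl : forall g, gmul (unit_arrow (rng g)) g = g ;
  gmul_unitr : forall g, gmul g (unit_arrow (src g)) = g ;
  gmulA : forall g h k, src g = rng h -> src h = rng k ->
    gmul g (gmul h k) = gmul (gmul g h) k ;
  src_ginv : forall g, src (ginv g) = rng g ;
  rng_ginv : forall g, rng (ginv g) = src g ;
  gmul_ginvl : forall g, gmul (ginv g) g = unit_arrow (src g) ;
  gmul_ginvr : forall g, gmul g (ginv g) = unit_arrow (rng g) ;
  src_continuous : continuous src ;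
  rng_continuous : continuous rng ;
  unit_arrow_continuous : continuous unit_arrow ;
  ginv_continuous : continuous ginv ;
  gmul_continuous : {within [set p : arrows * arrows | src p.1 = rng p.2],
    continuous (fun p => gmul p.1 p.2)} ;
  arrows_hausdorff : hausdorff_space arrows ;
  arrows_locally_compact : locally_compact [set: arrows] ;
  src_local_homeomorphism : local_homeomorphism src ;
  rng_local_homeomorphism : local_homeomorphism rng
}.

Arguments unit_arrow {e}.

Definition open_bisection (G : etale_groupoid) (U : set G) :=
  [/\ open U, set_inj U (@src G) & set_inj U (@rng G)].

Record left_action (G : etale_groupoid) (X : topologicalType) := LeftAction {
  lanchor : X -> units G ;
  lact : G -> X -> X ;
  lanchor_continuous : continuous lanchor ;
  lact_continuous : {within [set p : G * X | src p.1 = lanchor p.2],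
    continuous (fun p => lact p.1 p.2)} ;
  lanchor_act : forall g x, src g = lanchor x -> lanchor (lact g x) = rng g ;
  lact_unit : forall x, lact (unit_arrow (lanchor x)) x = x ;
  lact_gmul : forall g h x, src g = rng h -> src h = lanchor x ->
    lact (gmul g h) x = lact g (lact h x)
}.

Record right_action (H : etale_groupoid) (X : topologicalType) := RightAction {
  ranchor : X -> units H ;
  ract : X -> H -> X ;
  ranchor_continuous : continuous ranchor ;
  ract_continuous : {within [set p : X * H | ranchor p.1 = rng p.2],
    continuous (fun p => ract p.1 p.2)} ;
  ranchor_act : forall x h, ranchor x = rng h -> ranchor (ract x h) = src h ;
  ract_unit : forall x, ract x (unit_arrow (ranchor x)) = x ;
  ract_gmul : forall x h k, ranchor x = rng h -> src h = rng k ->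
    ract x (gmul h k) = ract (ract x h) k
}.

Record bispace (G H : etale_groupoid) (X : topologicalType) := Bispace {
  bispace_hausdorff : hausdorff_space X ;
  bispace_locally_compact : locally_compact [set: X] ;
  left_of :> left_action G X ;
  right_of : right_action H X ;
  lanchor_ract : forall x h, ranchor right_of x = rng h ->
    lanchor left_of (ract right_of x h) = lanchor left_of x ;
  ranchor_lact : forall g x, src g = lanchor left_of x ->
    ranchor right_of (lact left_of g x) = ranchor right_of x ;
  lact_ract : forall g x h, src g = lanchor left_of x ->
    ranchor right_of x = rng h ->
    lact left_of g (ract right_of x h) = ract right_of (lact left_of g x) h
}.

Definition lfree (G : etale_groupoid) (X : topologicalType)
    (a : left_action G X) :=
  forall g x, src g = lanchor a x -> lact a g x = x ->
    g = unit_arrow (lanchor a x).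

Definition rfree (H : etale_groupoid) (X : topologicalType)
    (a : right_action H X) :=
  forall x h, ranchor a x = rng h -> ract a x h = x ->
    h = unit_arrow (ranchor a x).

(* The map (g, x) |-> (g x, x) is proper: inverse images of compact sets are
   compact. *)
Definition lproper (G : etale_groupoid) (X : topologicalType)
    (a : left_action G X) :=
  forall K : set (X * X), compact K ->
    compact [set p : G * X |
      src p.1 = lanchor a p.2 /\ K (lact a p.1 p.2, p.2)].

Definition rproper (H : etale_groupoid) (X : topologicalType)
    (a : right_action H X) :=
  forall K : set (X * X), compact K ->
    compact [set p : X * H |
      ranchor a p.1 = rng p.2 /\ K (p.1, ract a p.1 p.2)].

Definition free_proper (G H : etale_groupoid) (X : topologicalType)
    (B : bispace G H X) :=
  [/\ lfree B, lproper B, rfree (right_of B) & rproper (right_of B)].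

Section OrbitSpace.
Context (G : etale_groupoid) (X : topologicalType) (a : left_action G X).

Definition same_orbit (x y : X) : bool :=
  `[< exists2 g : G, src g = lanchor a x & lact a g x = y >].

Lemma same_orbit_refl : reflexive same_orbit.
Proof.
move=> x; apply/asboolP; exists (unit_arrow (lanchor a x)).
  exact: src_unit.
exact: lact_unit.
Qed.

Lemma same_orbit_sub x y : same_orbit x y -> same_orbit y x.
Proof.
move=> /asboolP[g gx <-]; apply/asboolP; exists (ginv g).
  by rewrite lanchor_act // src_ginv.
by rewrite -lact_gmul ?src_ginv // gmul_ginvl gx lact_unit.
Qed.

Lemma same_orbit_sym : symmetric same_orbit.
Proof. by move=> x y; apply/idP/idP; exact: same_orbit_sub. Qed.

Lemma same_orbit_trans : transitive same_orbit.
Proof.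
move=> y x z /asboolP[g gx <-] /asboolP[h hy <-]; apply/asboolP.
have hg : src h = rng g by rewrite hy lanchor_act.
exists (gmul h g); first by rewrite src_gmul.
by rewrite lact_gmul.
Qed.

Definition orbit_equiv :=
  EquivRel same_orbit same_orbit_refl same_orbit_sym same_orbit_trans.

Definition orbit_space : Type := quotient_topology {eq_quot orbit_equiv}.
HB.instance Definition _ := Topological.on orbit_space.
HB.instance Definition _ := Quotient.on orbit_space.

Definition orbit_map : X -> orbit_space := \pi_orbit_space.

Lemma orbit_mapP x y : orbit_map x = orbit_map y <->
  exists2 g : G, src g = lanchor a x & lact a g x = y.
Proof.
rewrite /orbit_map; split=> [/eqmodP/asboolP//|xy]; apply/eqmodP.
exact/asboolP.
Qed.

Lemma repr_orbit x : exists2 g : G,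
  src g = lanchor a x & lact a g x = repr (orbit_map x).
Proof. by apply/orbit_mapP; rewrite /orbit_map reprK. Qed.

Lemma orbit_map_continuous : continuous orbit_map.
Proof. exact: pi_continuous. Qed.

Lemma orbit_map_open (A : set X) : open A -> open (orbit_map @` A).
Proof.
move=> oA.
suff : open (orbit_map @^-1` (orbit_map @` A)) by [].
rewrite openE => y [x Ax /esym/orbit_mapP[g gy gyx]].
have /subspace_continuousP/(_ (g, y) gy) := lact_continuous (l := a).
have Agy : nbhs (lact a g y) A by rewrite gyx; exact: open_nbhs_nbhs.
move=> /(_ A Agy); rewrite /nbhs /= /within => -[[N M] /= [Ng My] NMA].
have [U [oU Ug _ _ Uopen]] := src_local_homeomorphism g.
have oW : open (@src G @` (N° `&` U)).
  by apply: Uopen => [|? []//]; apply: openI => //; exact: open_interior.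
have : nbhs y (lanchor a @^-1` (@src G @` (N° `&` U)) `&` M).
  apply: filterI => //; apply: (lanchor_continuous (l := a)).
  by apply: open_nbhs_nbhs; split=> //; rewrite -gy; exists g.
apply: filterS => z [[h [Nh _] hz] Mz] /=.
exists (lact a h z); last by apply/esym/orbit_mapP; exists h.
by apply: (NMA (h, z)) => //=; split=> //; exact: interior_subset.
Qed.

End OrbitSpace.

HB.instance Definition _ (G : etale_groupoid) (X : ptopologicalType)
    (a : left_action G X) :=
  isPointed.Build (orbit_space a) (orbit_map a point).

Section InducedAction.
Context (G H : etale_groupoid) (X : topologicalType) (B : bispace G H X).

Let Y := orbit_space B.
Let q : X -> Y := orbit_map B.

Definition orbit_anchor (y : Y) : units H := ranchor (right_of B) (repr y).

Definition orbit_ract (y : Y) (h : H) : Y := q (ract (right_of B) (repr y) h).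

Lemma orbit_anchorE x : orbit_anchor (q x) = ranchor (right_of B) x.
Proof.
rewrite /orbit_anchor; have [g gx <-] := repr_orbit B x.
by rewrite ranchor_lact.
Qed.

Lemma orbit_ractE x h : ranchor (right_of B) x = rng h ->
  orbit_ract (q x) h = q (ract (right_of B) x h).
Proof.
move=> xh; rewrite /orbit_ract; have [g gx <-] := repr_orbit B x.
apply/esym/orbit_mapP; exists g; first by rewrite lanchor_ract.
exact: lact_ract.
Qed.

Lemma orbit_anchor_continuous : continuous orbit_anchor.
Proof.
apply/quotient_continuous.
rewrite (_ : _ \o _ = ranchor (right_of B)); first exact: ranchor_continuous.
by apply/funext => x; exact: orbit_anchorE.
Qed.

Lemma orbit_ract_continuous :
  {within [set p : Y * H | orbit_anchor p.1 = rng p.2],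
    continuous (fun p => orbit_ract p.1 p.2)}.
Proof.
apply/subspace_continuousP => -[y h] /=; have [x ->] : exists x, y = q x.
  by exists (repr y); rewrite /q /orbit_map reprK.
rewrite orbit_anchorE => xh W Wxh.
have qW : nbhs (ract (right_of B) x h) (q @^-1` W).
  by apply: orbit_map_continuous; rewrite -[orbit_map B _]orbit_ractE.
have /subspace_continuousP/(_ (x, h) xh) := ract_continuous (r := right_of B).
move=> /(_ _ qW); rewrite /nbhs /= /within => -[[N M] /= [Nx Mh] NMW].
exists (q @` N°, M) => /=.
  split=> //; apply: open_nbhs_nbhs; split.
    by apply: orbit_map_open; exact: open_interior.
  by exists x.
move=> [_ k] /= [[z Nz <-] Mk]; rewrite orbit_anchorE => zk.
suff : W (orbit_ract (q z) k) by [].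
rewrite orbit_ractE //.
by apply: (NMW (z, k)) => //=; split=> //; exact: interior_subset.
Qed.

Lemma orbit_anchor_act y h : orbit_anchor y = rng h ->
  orbit_anchor (orbit_ract y h) = src h.
Proof. by move=> yh; rewrite orbit_anchorE ranchor_act. Qed.

Lemma orbit_ract_unit y : orbit_ract y (unit_arrow (orbit_anchor y)) = y.
Proof. by rewrite /orbit_ract ract_unit /q /orbit_map reprK. Qed.

Lemma orbit_ract_gmul y h k : orbit_anchor y = rng h -> src h = rng k ->
  orbit_ract y (gmul h k) = orbit_ract (orbit_ract y h) k.
Proof.
move=> yh hk; rewrite [in RHS]orbit_ractE ?ranchor_act //.
by rewrite /orbit_ract ract_gmul.
Qed.

Definition orbit_action : right_action H Y :=
  RightAction orbit_anchor_continuous orbit_ract_continuous orbit_anchor_act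
    orbit_ract_unit orbit_ract_gmul.

End InducedAction.

Notation borel X := (g_sigma_algebraType (@open X)).

Notation borel_measure R X := ({measure set (borel X) -> \bar R})%R.

Section Measures.
Local Open Scope ereal_scope.
Context (R : realType) (X : ptopologicalType).
Implicit Types mu nu : borel_measure R X.

(* The values of a [measure] on nonmeasurable sets are unconstrained, so Leibniz
   equality is too fine. *)
Definition eq_borel mu nu :=
  forall A : set (borel X), measurable A -> mu A = nu A.

(* Inner regularity is only required on open sets: X need not be second
   countable, and these are the measures that represent the positive linear
   functionals on C_c(X). *)
Definition radon mu :=
  [/\ forall K : set X, compact K -> mu K < +oo,
      forall A : set (borel X), measurable A ->
        mu A = ereal_inf
          [set mu U | U in [set U : set X | open U /\ A `<=` U]] &
      forall U : set X, open U ->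
        mu U = ereal_sup
          [set mu K | K in [set K : set X | compact K /\ K `<=` U]]].

(* theta is the graph of a partial homeomorphism of X; nu restricts on its range
   to the transport of mu. The extension by zero of that transport need not be
   finite on compact sets of X, so it is not itself taken as a measure on X. *)
Definition transports (theta : X -> X -> Prop) mu nu :=
  forall A : set (borel X), measurable A ->
    A `<=` [set x | exists y, theta x y] ->
    nu [set y | exists2 x, A x & theta x y] = mu A.

End Measures.

Definition left_translation (G : etale_groupoid) (X : topologicalType)
    (a : left_action G X) (U : set G) (x y : X) : Prop :=
  exists g : G, [/\ U g, src g = lanchor a x & y = lact a g x].

Definition right_translation (H : etale_groupoid) (X : topologicalType)
    (a : right_action H X) (V : set H) (x y : X) : Prop :=
  exists h : H, [/\ V h, ranchor a x = rng h & y = ract a x h].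

Definition invariant (R : realType) (G : etale_groupoid) (X : ptopologicalType)
    (a : left_action G X) (rho : borel_measure R X) :=
  forall U : set G, open_bisection U ->
    transports (left_translation a U) rho rho.

Definition invariant_radon (R : realType) (G : etale_groupoid)
    (X : ptopologicalType) (a : left_action G X) (rho : borel_measure R X) :=
  radon rho /\ invariant a rho.

(* Main.v *)
Require Import Defs.
From HB Require Import structures.
From mathcomp Require Import all_boot all_order all_algebra.
From mathcomp Require Import all_classical all_reals all_analysis.
From mathcomp Require Import lra.

(** The orbit map [q : X -> G\X] of a free and proper action of an étale
    groupoid is a local homeomorphism onto a Hausdorff space. A measure [rho] on
    [X] and a measure [mu] on [G\X] can therefore be compared over the open sets
    [W] on which [q] is injective: they correspond to each other when
    [mu (q A) = rho A] for all such [W] and all Borel [A] inside [W]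
    ([quotient_of]). The proof rests on two facts on Radon measures, stated for
    partial homeomorphisms between Hausdorff spaces.

    Locality ([transports_local]): whether a partial homeomorphism transports one
    Radon measure to another can be tested near each point. The test passes to
    compact sets by finite covers, then to open sets by inner regularity, and
    then to Borel sets by outer regularity.

    Gluing ([glue_radon]): a Radon measure on [X] and a compatible family of
    partial homeomorphisms from [X] whose ranges cover [Z] determine a Radon
    measure on [Z]. The spaces need not be second countable, so the ranges
    may admit no countable subcover, and the measure cannot be written as a
    countable sum over pieces. Instead, a Borel set is first given the supremum
    of what finite families of disjoint small Borel subsets contribute, which is
    already a measure; it is then made outer regular by raising it to infinity
    on the sets without open neighbourhoods of finite measure.

    Gluing along the restrictions of [q] to the sets [W] turns [rho] into [mu].
    Compatibility ([invariant_chart]) is where the invariance of [rho]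
    enters: going from [W] to another such set along the orbits is, near
    each point, the translation by an open bisection of [G]. Gluing along the
    inverses turns [mu] into [rho], and there compatibility is automatic.

    The remaining claims are instances of one principle. Let a partial
    homeomorphism of [X] lie over one of [G\X]. If the latter transports [mu] to
    [mu'], then the former transports [rho] to [rho'] ([transports_lift]); the
    converse holds if the domain upstairs is the full preimage of the domain
    downstairs ([transports_descend]). Over the identity of [G\X] lie the
    translations by bisections of [G], which makes the measures built from [mu]
    invariant, and the identity of [X], which makes the correspondence
    one-to-one. Over the translations of [G\X] by bisections of [H] lie those of
    [X], which is equivariance. Additivity follows from uniqueness, as the
    defining relation is additive. *)

Set Implicit Arguments.
Unset Strict Implicit.
Unset Printing Implicit Defensive.

Import Order.TTheory GRing.Theory Num.Theory.
Local Open Scope classical_set_scope.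
Local Open Scope ereal_scope.

(** Abbreviations rather than definitions, so that images of Borel sets match the
    body of [transports] as it stands. *)
Local Notation rimage theta A := [set y | exists2 x, A x & theta x y].
Local Notation rdom theta := [set x | exists y, theta x y].
Local Notation rinv theta := (fun y x => theta x y).
Local Notation borel_set X A := (measurable (A : set (borel X))).

(** * Suprema, compact sets and partial homeomorphisms *)

Lemma ereal_sup_add_le (R : realType) (S T : set (\bar R)) c :
  S !=set0 -> T !=set0 -> S `<=` [set x | 0 <= x] -> T `<=` [set x | 0 <= x] ->
  (forall a b, S a -> T b -> a + b <= c) -> ereal_sup S + ereal_sup T <= c.
Proof.
move=> [a0 Sa0] [b0 Tb0] S0 T0 STc.
have [->|fc] := eqVneq c +oo; first exact: leey.
have {}fc : c < +oo by rewrite ltey.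
have fT b : T b -> b \is a fin_num.
  move=> Tb; rewrite ge0_fin_numE ?T0//; apply: le_lt_trans fc.
  by apply: (le_trans _ (STc _ _ Sa0 Tb)); rewrite leeDr// S0.
have S1 b : T b -> ereal_sup S <= c - b.
  move=> Tb; apply: ge_ereal_sup => a Sa; rewrite leeBrDr ?fT//; exact: STc.
have fS : ereal_sup S \is a fin_num.
  rewrite ge0_fin_numE; last by apply: le_ereal_sup_tmp; exists a0 => //; exact: S0.
  apply: (le_lt_trans (S1 _ Tb0)); rewrite lte_add_pinfty// ltey.
  by rewrite eqe_oppLR; move: (fT _ Tb0); rewrite fin_numE => /andP[].
rewrite -leeBrDl//; apply: ge_ereal_sup => b Tb.
by rewrite leeBrDl// -leeBrDr ?fT// S1.
Qed.

Section Compact.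
Context (X : topologicalType).

(** Replaces finite subcovers: one set covers [K] and inherits, through binary
    unions, what is known of the open sets around the points of [K]. *)
Lemma compact_absorb (K : set X) (P : set X -> Prop) :
  compact K -> P set0 -> (forall A B, P A -> P B -> P (A `|` B)) ->
  (forall x, K x -> exists U, [/\ open U, U x & P U]) ->
  exists2 U, K `<=` U & P U.
Proof.
move=> /compact_near_coveringP cK P0 PU Kcov.
(* The families that contain every large enough set with property [P]. *)
pose F : set_system (set X) := [set S | exists2 A, P A &
  forall B, P B -> A `<=` B -> S B].
have FF : Filter F.
  split; first by exists set0.
  - move=> S T [A PA AS] [B PB BT]; exists (A `|` B); first exact: PU.
    move=> C PC ABC; split; [apply: AS|apply: BT] => // x ?; apply: ABC;
      by [left|right].
  - by move=> S T ST [A PA AS]; exists A => // B PB AB; exact/ST/AS.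
have : \near F, K `<=` F.
  apply: cK => x /Kcov[U [oU Ux PUU]].
  exists (U, [set B | U `<=` B]) => /=.
    by split; [exact: open_nbhs_nbhs|exists U].
  by move=> [y B] /= [Uy]; exact.
by case=> A PA /(_ A PA)AK; exists A => // x; exact: AK.
Qed.

End Compact.

Lemma open_borel (X : ptopologicalType) (U : set X) : open U -> borel_set X U.
Proof. by move=> oU; exact: sub_sigma_algebra. Qed.

Lemma compact_borel (X : ptopologicalType) (K : set X) :
  hausdorff_space X -> compact K -> borel_set X K.
Proof.
move=> hX cK; rewrite -[K]setCK; apply: measurableC; apply: open_borel.
by apply: closed_openC; exact: compact_closed.
Qed.

(** A homeomorphism between open subsets of [X] and [Z], given by its graph, which
    is the form in which translations by bisections come. *)
Record partial_homeo (X Z : topologicalType) (theta : X -> Z -> Prop) :=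
  PartialHomeo {
  phomeo_functional : forall x y y', theta x y -> theta x y' -> y = y' ;
  phomeo_injective : forall x x' y, theta x y -> theta x' y -> x = x' ;
  phomeo_open : forall U : set X, open U -> open (rimage theta U) ;
  phomeo_continuous : forall V : set Z, open V -> open (rimage (rinv theta) V)
}.

Lemma partial_homeo_inv (X Z : topologicalType) (theta : X -> Z -> Prop) :
  partial_homeo theta -> partial_homeo (rinv theta).
Proof.
by move=> [f i o c]; split => // [x y y'|x x' y]; [exact: i|exact: f].
Qed.

Lemma partial_homeo_eq (X : topologicalType) : partial_homeo (@eq X).
Proof.
have E (U : set X) : rimage (@eq X) U = U.
  by apply/seteqP; split=> [x [y Uy <-]//|x Ux]; exists x.
have E' (U : set X) : rimage (rinv (@eq X)) U = U.
  by apply/seteqP; split=> [x [y Uy ->]//|x Ux]; exists x.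
by split => [x y y' <-|x x' y -> ->|U|U]; rewrite ?E ?E'.
Qed.

Section PartialHomeo.
Context (X Z : topologicalType) (theta : X -> Z -> Prop).
Hypothesis htheta : partial_homeo theta.

Lemma open_rdom : open (rdom theta).
Proof.
rewrite (_ : rdom theta = rimage (rinv theta) setT).
  exact: phomeo_continuous htheta _ openT.
by apply/seteqP; split=> [x [y xy]|x [y _ xy]]; exists y.
Qed.

Lemma rimageK A : A `<=` rdom theta -> rimage (rinv theta) (rimage theta A) = A.
Proof.
move=> Ad; apply/seteqP; split=> [x [y [x' Ax' x'y] xy]|x Ax].
  by rewrite (phomeo_injective htheta xy x'y).
by have [y xy] := Ad _ Ax; exists y => //; exists x.
Qed.

Lemma rimage_sub A B : A `<=` B -> rimage theta A `<=` rimage theta B.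
Proof. by move=> AB y [x Ax xy]; exists x => //; exact: AB. Qed.

Lemma rimage_rdom A : rimage theta A `<=` rdom (rinv theta).
Proof. by move=> y [x _ xy]; exists x. Qed.

Lemma rimageI A B : rimage theta (A `&` B) = rimage theta A `&` rimage theta B.
Proof.
apply/seteqP; split=> [y [x [Ax Bx] xy]|y [[x Ax xy] [x' Bx' x'y]]].
  by split; exists x.
by exists x => //; split => //; rewrite (phomeo_injective htheta xy x'y).
Qed.

Lemma rimageD A B : rimage theta (A `\` B) = rimage theta A `\` rimage theta B.
Proof.
apply/seteqP; split=> [y [x [Ax Bx] xy]|y [[x Ax xy] nB]].
  split; first by exists x.
  by case=> x' Bx' x'y; apply: Bx; rewrite (phomeo_injective htheta xy x'y).
by exists x => //; split => // Bx; apply: nB; exists x.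
Qed.

Lemma rimage_bigcup (F : nat -> set X) :
  rimage theta (\bigcup_n F n) = \bigcup_n rimage theta (F n).
Proof.
apply/seteqP; split=> [y [x [n _ Fx] xy]|y [n _ [x Fx xy]]].
  by exists n => //; exists x.
by exists x => //; exists n.
Qed.

Lemma rimage_trivIset (F : nat -> set X) : trivIset setT F ->
  trivIset setT (fun n => rimage theta (F n)).
Proof.
move=> tF i j _ _ [y [[x Fx xy] [x' Fx' x'y]]]; apply: tF => //.
by exists x; split=> //; rewrite (phomeo_injective htheta xy x'y).
Qed.

(** A compact subset of the domain is the image of itself under a function that is
    continuous on it: any choice of values for the relation. *)
Lemma rimage_compact K : compact K -> K `<=` rdom theta ->
  compact (rimage theta K).
Proof.
move=> cK Kd.
have [K0|/set0P[x0 /Kd [y0 _]]] := eqVneq K set0.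
  rewrite (_ : rimage _ _ = set0); first exact: compact0.
  by apply/seteqP; split=> // y [x]; rewrite K0.
pose f x := xget y0 (theta x).
have fP x : rdom theta x -> theta x (f x).
  by move=> [y xy]; apply: (xgetPex y0); exists y.
rewrite (_ : rimage _ _ = f @` K).
  apply: continuous_compact => //; apply/subspace_continuousP => x Kx V.
  move=> Vx; have : nbhs (f x) V by []; rewrite nbhsE => -[V' [oV' V'x] V'V].
  suff : \forall z \near x, K z -> V (f z) by [].
  apply: (@filterS _ (nbhs x) _ (rimage (rinv theta) V')).
    move=> z [y V'y zy] Kz; apply: (V'V (f z)).
    by rewrite (phomeo_functional htheta (fP _ (Kd _ Kz)) zy).
  apply: open_nbhs_nbhs; split; first exact: (phomeo_continuous htheta).
  by exists (f x) => //; exact/fP/Kd.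
apply/seteqP; split=> [y [x Kx xy]|_ [x Kx <-]].
  by exists x => //; exact: (phomeo_functional htheta (fP _ (Kd _ Kx)) xy).
by exists x => //; exact/fP/Kd.
Qed.

End PartialHomeo.

(** Injectivity makes taking images commute with complements up to the range, so
    the sets with Borel image form a sigma-algebra that contains the open
    sets. *)
Lemma rimage_borel (X Z : ptopologicalType) (theta : X -> Z -> Prop)
  (htheta : partial_homeo theta) A : borel_set X A -> borel_set Z (rimage theta A).
Proof.
suff : <<s @open X >> `<=` [set A | borel_set Z (rimage theta A)].
  by move=> H /H.
apply: smallest_sub; last first.
  by move=> U oU; exact: open_borel (phomeo_open htheta oU).
split => /=.
- rewrite (_ : rimage _ _ = set0); first exact: (@measurable0 _ (borel Z)).
  by apply/seteqP; split=> // y [x].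
- move=> B mB; rewrite (rimageD htheta); apply: (@measurableD _ (borel Z)) => //.
  exact: open_borel (phomeo_open htheta openT).
- move=> F mF; rewrite rimage_bigcup.
  exact: (@bigcupT_measurable _ (borel Z)).
Qed.

(** * Regularity of Radon measures *)

Section Radon.
Context (R : realType) (X : ptopologicalType).
Hypothesis hX : hausdorff_space X.
Implicit Types mu : borel_measure R X.

Lemma radon_nbhs_finite mu x : radon mu ->
  exists U : set X, [/\ open U, U x & mu U < +oo].
Proof.
move=> [fin out _]; have cx := @compact_set1 _ x.
have := fin _ cx; rewrite out; last exact: compact_borel.
move=> /ereal_inf_ltP[_ [U [oU xU] <-] Ufin]; exists U; split => //; exact: xU.
Qed.

(** Inner regularity holds for open sets by definition; it extends to the Borel
    sets of finite measure because these are approximated by open sets from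
    outside. *)
Lemma radon_inner mu A : radon mu -> borel_set X A -> mu A < +oo ->
  mu A <= ereal_sup [set mu K | K in [set K : set X | compact K /\ K `<=` A]].
Proof.
move=> [fin out inn] mA fA.
set s := ereal_sup _.
(* [e] is lost three times: from [A] to [U], from [U `\` A] to [V] and from [L]
   to [U]. *)
suff H (e : R) : (0 < e)%R -> mu A <= s + (e + e + e)%:E.
  apply/lee_addgt0Pr => e e0.
  have e3 : (0 < e / 3)%R by rewrite divr_gt0.
  apply: (le_trans (H _ e3)); rewrite leeD2l// lee_fin.
  by lra.
move=> e0.
have approx (B : set X) : borel_set X B -> mu B < +oo ->
    exists U : set X, [/\ open U, B `<=` U & mu U <= mu B + e%:E].
  move=> mB fB; have := out _ mB => E.
  have fB' : mu B \is a fin_num by rewrite ge0_fin_numE.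
  move: (fB'); rewrite E => /(lb_ereal_inf_adherent e0)[_ [U [oU BU] <-]].
  by rewrite -E => /ltW; exists U.
have [U [oU AU Ule]] := approx _ mA fA.
have fU : mu U < +oo by rewrite (le_lt_trans Ule)// lte_add_pinfty ?ltry.
have mU := open_borel oU.
have muUA : mu (U `\` A) <= e%:E.
  rewrite measureD//; have -> : U `&` A = A by rewrite setIC; exact/setIidPl.
  by rewrite leeBlDl// ge0_fin_numE.
have mUA : borel_set X (U `\` A) by exact: measurableD.
have [V [oV UAV Vle]] := approx _ mUA (le_lt_trans muUA (ltry _)).
have : ereal_sup [set mu K | K in [set K | compact K /\ K `<=` U]] \is a fin_num.
  by rewrite -inn// ge0_fin_numE.
move=> /(ub_ereal_sup_adherent e0)[_ [L [cL LU] <-]]; rewrite -inn// => Llt.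
(* [L `\` V] lies in [A], since [V] covers the part of [U] outside [A]. *)
have cK : compact (L `\` V).
  rewrite setDE; apply: compact_closedI => //; exact: open_closedC.
have KA : L `\` V `<=` A.
  by move=> x [Lx nVx]; apply: contrapT => nA; apply/nVx/UAV; split => //; exact: LU.
have mL := compact_borel hX cL.
have mV := open_borel oV.
have Ls : mu (L `\` V) <= s by apply: ereal_sup_ubound; exists (L `\` V).
apply: (@le_trans _ _ (mu U)); first by apply: le_measure; rewrite ?inE.
have : mu U <= mu L + e%:E by rewrite -leeBlDr// ltW.
move=> /le_trans; apply; rewrite !EFinD addeA leeD2r//.
rewrite (@measureDI _ _ _ mu L V)// leeD//.
apply: (@le_trans _ _ (mu V)); first exact: measureIr.
by apply: (le_trans Vle); rewrite leeD2r.
Qed.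

Lemma borel_measure_addE mu nu (A : set (borel X)) :
  (measure_add mu nu : borel_measure R X) A = mu A + nu A.
Proof. exact: measure_addE. Qed.

(** The optimal open sets for [mu] and [nu] differ, and likewise the compact sets:
    intersecting the former and uniting the latter serves both measures. *)
Lemma radon_add mu nu : radon mu -> radon nu -> radon (measure_add mu nu).
Proof.
move=> [f1 o1 i1] [f2 o2 i2]; split.
- move=> K cK; rewrite borel_measure_addE lte_add_pinfty//; [exact: f1|exact: f2].
- move=> A mA; rewrite borel_measure_addE; apply/eqP; rewrite eq_le; apply/andP; split.
    apply: le_ereal_inf_tmp => _ [U [oU AU] <-]; rewrite borel_measure_addE.
    have mU := open_borel oU.
    by rewrite leeD// le_measure ?inE.
  have [fA|] := ltP (mu A) +oo; last first.
    rewrite leye_eq => /eqP ->.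
    by rewrite addye ?leey// gt_eqF// (lt_le_trans _ (measure_ge0 _ _)).
  have [fA'|] := ltP (nu A) +oo; last first.
    rewrite leye_eq => /eqP ->.
    by rewrite addey ?leey// gt_eqF// (lt_le_trans _ (measure_ge0 _ _)).
  apply/lee_addgt0Pr => e e0; have e2 : (0 < e / 2)%R by rewrite divr_gt0.
  have : mu A \is a fin_num by rewrite ge0_fin_numE.
  rewrite {1}o1// => /(lb_ereal_inf_adherent e2)[_ [U [oU AU] <-]] Ult.
  have : nu A \is a fin_num by rewrite ge0_fin_numE.
  rewrite {1}o2// => /(lb_ereal_inf_adherent e2)[_ [V [oV AV] <-]] Vlt.
  move: Ult Vlt; rewrite -o1// -o2// => Ult Vlt.
  have mU := open_borel oU; have mV := open_borel oV.
  have oUV : open (U `&` V) by exact: openI.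
  have mUV := open_borel oUV.
  apply: ge_ereal_inf; exists ((measure_add mu nu : borel_measure R X) (U `&` V)).
    by exists (U `&` V) => //; split=> // x Ax; split; [exact: AU|exact: AV].
  rewrite borel_measure_addE [e in e%:E]splitr EFinD addeACA leeD//.
    by apply: (le_trans _ (ltW Ult)); exact: measureIl.
  by apply: (le_trans _ (ltW Vlt)); exact: measureIr.
- move=> U oU; have mU := open_borel oU.
  rewrite borel_measure_addE; apply/eqP; rewrite eq_le; apply/andP; split; last first.
    apply: ge_ereal_sup => _ [K [cK KU] <-]; rewrite borel_measure_addE.
    have mK := compact_borel hX cK.
    by rewrite leeD// le_measure ?inE.
  rewrite i1// i2//.
  apply: ereal_sup_add_le.
  - by exists (mu set0), set0 => //; split => //; exact: compact0.
  - by exists (nu set0), set0 => //; split => //; exact: compact0.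
  - by move=> _ [K _ <-] /=.
  - by move=> _ [K _ <-] /=.
  - move=> _ _ [K [cK KU] <-] [L [cL LU] <-].
    have cKL : compact (K `|` L) by exact: compactU.
    apply: le_ereal_sup_tmp; exists ((measure_add mu nu : borel_measure R X) (K `|` L)).
      by exists (K `|` L) => //; split=> // x [/KU|/LU].
    have mKL := compact_borel hX cKL.
    rewrite borel_measure_addE leeD// le_measure ?inE//; do ?exact: compact_borel;
      by move=> x ?; [left|right].
Qed.

End Radon.

(** * Transport of Radon measures is a local property *)

Definition transports_to (R : realType) (X Z : ptopologicalType)
    (theta : X -> Z -> Prop) (rho : borel_measure R X)
    (mu : borel_measure R Z) :=
  forall A, borel_set X A -> A `<=` rdom theta -> mu (rimage theta A) = rho A.

Lemma transports_to_inv (R : realType) (X Z : ptopologicalType)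
    (theta : X -> Z -> Prop) (rho : borel_measure R X)
    (mu : borel_measure R Z) : partial_homeo theta ->
  transports_to theta rho mu -> transports_to (rinv theta) mu rho.
Proof.
move=> ht t A mA Ad; have hi := partial_homeo_inv ht.
by rewrite -t ?(rimageK hi)//; [exact: rimage_borel|exact: rimage_rdom].
Qed.

(** Equality of measures is transport by the identity, so that results on transport
    yield uniqueness results. *)
Lemma transports_to_eq (R : realType) (X : ptopologicalType)
  (mu nu : borel_measure R X) : transports_to (@eq X) mu nu <-> eq_borel mu nu.
Proof.
have E (A : set X) : rimage (@eq X) A = A.
  by apply/seteqP; split=> [x [y Ay <-]//|x Ax]; exists x.
split=> [t A mA|t A mA _]; last by rewrite E t.
by rewrite -t ?E// => x _; exists x.
Qed.

Section TransportsLocal.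
Context (R : realType).

(** The sets on which the local hypothesis holds are stable under binary unions,
    as the measures can be computed after cutting along one of them. *)
Lemma transports_compact (X Z : ptopologicalType)
    (theta : X -> Z -> Prop) (rho : borel_measure R X)
    (mu : borel_measure R Z) K :
  hausdorff_space X -> partial_homeo theta ->
  (forall x, rdom theta x -> exists N : set X, [/\ open N, N x &
    forall A, borel_set X A -> A `<=` N -> A `<=` rdom theta ->
      mu (rimage theta A) = rho A]) ->
  compact K -> K `<=` rdom theta -> mu (rimage theta K) = rho K.
Proof.
move=> hX ht loc cK Kd; have mK := compact_borel hX cK.
pose P (N : set X) := open N /\
  forall A, borel_set X A -> A `<=` N -> A `<=` rdom theta ->
      mu (rimage theta A) = rho A.
have [N KN [_ PN]] : exists2 N, K `<=` N & P N.
  apply: (compact_absorb cK); first split.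
  - exact: open0.
  - move=> A mA A0 _; have -> : A = set0 by apply/seteqP; split.
    rewrite (_ : rimage _ _ = set0) ?measure0//.
    by apply/seteqP; split=> // y [].
  - move=> M N [oM PM] [oN PN]; split; first exact: openU.
    move=> A mA AMN Ad; have mM := open_borel oM.
    have mA1 : borel_set X (A `\` M) by exact: measurableD.
    have mA2 : borel_set X (A `&` M) by exact: measurableI.
    rewrite (measureDI rho mA mM) (measureDI mu (rimage_borel ht mA) (rimage_borel ht mM)).
    rewrite -(rimageI ht) -(rimageD ht).
    congr (_ + _); [apply: PN => //|apply: PM => //].
        + by move=> x [Ax nMx]; have [] := AMN x Ax.
    + by move=> x [Ax _]; exact: Ad.
    + by move=> x [Ax _]; exact: Ad.
  - move=> x /Kd/loc[N [oN Nx PN]]; by exists N.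
exact: PN.
Qed.

(** Only one inequality is needed: the reverse one is the same statement for the
    inverse of [theta]. *)
Lemma transports_le (X Z : ptopologicalType)
    (theta : X -> Z -> Prop) (rho : borel_measure R X)
    (mu : borel_measure R Z) A :
  hausdorff_space X -> hausdorff_space Z -> radon rho -> radon mu ->
  partial_homeo theta ->
  (forall K, compact K -> K `<=` rdom theta -> mu (rimage theta K) = rho K) ->
  borel_set X A -> A `<=` rdom theta -> mu (rimage theta A) <= rho A.
Proof.
move=> hX hZ [_ outX _] [_ _ innZ] ht tK mA Ad.
have hi := partial_homeo_inv ht.
have leU (U : set X) : open U -> U `<=` rdom theta -> mu (rimage theta U) <= rho U.
  move=> oU Ud; rewrite innZ; last exact: (phomeo_open ht).
  apply: ge_ereal_sup => _ [K [cK KU] <-].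
  have Kd : K `<=` rdom (rinv theta) by move=> y /KU[x _ xy]; exists x.
  have cK' := rimage_compact hi cK Kd.
  rewrite -(rimageK hi Kd) tK//; last exact: (rimage_rdom (theta:=rinv theta)).
  apply: le_measure; rewrite ?inE; [exact: compact_borel|exact: open_borel|].
  by rewrite -(rimageK ht Ud); exact: rimage_sub.
rewrite outX//; apply: le_ereal_inf_tmp => _ [U [oU AU] <-].
have oU' : open (U `&` rdom theta) by exact/openI/open_rdom.
apply: (@le_trans _ _ (mu (rimage theta (U `&` rdom theta)))).
  apply: le_measure; rewrite ?inE; [exact: rimage_borel|exact: open_borel (phomeo_open ht oU')|].
  by apply: rimage_sub => x Ax; split; [exact: AU|exact: Ad].
apply: le_trans (leU _ oU' _) _; first by move=> x [].
by apply: le_measure; rewrite ?inE; [exact: open_borel..|move=> x []].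
Qed.

(** The values on compact sets determine a Radon measure, and compact sets only see
    finitely many of the neighbourhoods provided by the hypothesis. *)
Lemma transports_local (X Z : ptopologicalType)
    (theta : X -> Z -> Prop) (rho : borel_measure R X)
    (mu : borel_measure R Z) :
  hausdorff_space X -> hausdorff_space Z -> radon rho -> radon mu ->
  partial_homeo theta ->
  (forall x, rdom theta x -> exists N : set X, [/\ open N, N x &
    forall A, borel_set X A -> A `<=` N -> A `<=` rdom theta ->
      mu (rimage theta A) = rho A]) ->
  transports_to theta rho mu.
Proof.
move=> hX hZ rX rZ ht loc A mA Ad; have hi := partial_homeo_inv ht.
have tK := transports_compact hX ht loc.
apply/eqP; rewrite eq_le (transports_le hX hZ rX rZ ht)//=.
rewrite -{1}(rimageK ht Ad); apply: (transports_le hZ hX rZ rX hi).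
- move=> K cK Kd; rewrite -tK ?(rimageK hi Kd)//; first exact: rimage_compact.
  exact: rimage_rdom.
- exact: rimage_borel.
- exact: rimage_rdom.
Qed.

End TransportsLocal.

(** * From inner regular to Radon measures *)

Section Regularization.
Context (R : realType) (Z : ptopologicalType).

Lemma borel_measureP (f : set (borel Z) -> \bar R) :
  f set0 = 0 -> (forall A, 0 <= f A) ->
  (forall F : nat -> set (borel Z), (forall n, measurable (F n)) ->
    trivIset setT F -> f (\bigcup_n F n) = \sum_(n <oo) f (F n)) ->
  exists mu : borel_measure R Z, mu = f :> (set (borel Z) -> \bar R).
Proof.
move=> f0 fge0 fs.
have fsa : semi_sigma_additive f.
  move=> F mF tF _; rewrite fs//; exact: is_cvg_nneseries.
pose mf := isMeasure.Build _ (borel Z) R f f0 fge0 fsa.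
pose mu : borel_measure R Z := HB.pack f mf.
by exists mu.
Qed.

Definition outer_finite (m0 : borel_measure R Z) (A : set Z) :=
  exists U : set Z, [/\ open U, A `<=` U & m0 U < +oo].

(** Without sigma-finiteness, an inner regular measure can be too small to be outer
    regular: an uncountable set may be null while all its open neighbourhoods
    have infinite measure. Such sets have to get measure infinity; on the other
    sets [m0] is already outer regular, by inner regularity of complements in
    an open set of finite measure. *)
Lemma radon_regularization (m0 : borel_measure R Z) :
  hausdorff_space Z ->
  (forall z, exists U : set Z, [/\ open U, U z & m0 U < +oo]) ->
  (forall A, borel_set Z A ->
    m0 A <= ereal_sup [set m0 K | K in [set K : set Z | compact K /\ K `<=` A]]) ->
  exists2 mu : borel_measure R Z, radon mu &
    forall A, outer_finite m0 A -> mu A = m0 A.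
Proof.
move=> hZ m0loc m0inn; pose fin := outer_finite m0.
(* Remove from [U] a compact set that fills [U `\` A] up to [e]. *)
have approx (A : set Z) (e : R) : borel_set Z A -> fin A -> (0 < e)%R ->
    exists V : set Z, [/\ open V, A `<=` V & m0 V <= m0 A + e%:E].
  move=> mA [U [oU AU fU]] e0; have mU := open_borel oU.
  have mUA : borel_set Z (U `\` A) by exact: measurableD.
  have lec : m0 (U `\` A) <= m0 U by apply: le_measure; rewrite ?inE.
  set s := ereal_sup [set m0 K | K in [set K : set Z | compact K /\ K `<=` U `\` A]].
  have sE : s = m0 (U `\` A).
    apply/eqP; rewrite eq_le m0inn// andbT.
    apply: ge_ereal_sup => _ [K [cK KUA] <-]; apply: le_measure; rewrite ?inE//.
    exact: compact_borel.
  have fs : s \is a fin_num by rewrite sE ge0_fin_numE// (le_lt_trans lec).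
  have [_ [K [cK KUA] <-]] := ub_ereal_sup_adherent e0 fs.
  rewrite -/s sE => Klt; have mK := compact_borel hZ cK.
  have oV : open (U `\` K).
    by rewrite setDE; apply: openI => //; exact: closed_openC (compact_closed hZ cK).
  exists (U `\` K); split => //.
    by move=> x Ax; split; [exact: AU|move=> /KUA[]].
  rewrite (@measureDI _ _ _ m0 (U `\` K) A)//; last exact: open_borel.
  rewrite addeC leeD//.
    by apply: le_measure; rewrite ?inE//; exact: measurableI (open_borel oV) mA.
  rewrite setDDl setUC -setDDl measureD//; last exact: le_lt_trans lec fU.
  have -> : (U `\` A) `&` K = K by rewrite setIC; exact/setIidPl.
  have fK : m0 K \is a fin_num.
    by rewrite ge0_fin_numE// (le_lt_trans _ (le_lt_trans lec fU))// le_measure ?inE.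
  by rewrite leeBlDl// -leeBlDr// ltW.
pose f (A : set (borel Z)) := if `[< fin A >] then m0 A else +oo.
have fE A : fin A -> f A = m0 A by move=> /asboolP; rewrite /f => ->.
have fN A : ~ fin A -> f A = +oo by move=> /asboolPn/negbTE; rewrite /f => ->.
have fge0 A : 0 <= f A by rewrite /f; case: ifP.
have fin0 : fin set0 by exists set0; rewrite measure0; split => //; exact: open0.
have finS A B : A `<=` B -> fin B -> fin A.
  by move=> AB [U [oU BU fU]]; exists U; split => // x /AB/BU.
have fopen U : open U -> f U = m0 U.
  move=> oU; have [/fE//|nU] := pselect (fin U); rewrite fN//.
  apply/esym/eqP; rewrite -leye_eq leNgt; apply/negP => fU.
  by apply: nU; exists U; split => // x.
have [||F mF tF|mu muE] := @borel_measureP f.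
- by rewrite fE ?measure0.
- exact: fge0.
- have [finU|nU] := pselect (fin (\bigcup_n F n)).
    have finF n : fin (F n) by apply: finS finU => x Fx; exists n.
    rewrite fE// measure_semi_bigcup//; last exact: bigcupT_measurable.
    by apply: eq_eseriesr => n _; rewrite fE.
  rewrite fN//; have [finF|] := pselect (forall n, fin (F n)); last first.
    move=> /existsNP[n nn]; rewrite (eseries_pinfty _ _ (fN _ nn))// => k _.
    by rewrite -ltNye (lt_le_trans _ (fge0 _)).
  rewrite (eq_eseriesr (g := m0 \o F)); last by move=> n _; rewrite /= fE.
  (* A finite sum would give open sets around the [F n] whose measures are
     summable, so that their union shows [\bigcup_n F n] to be in [fin]. *)
  apply/esym/eqP; rewrite -leye_eq leNgt; apply/negP => fsum.
  have e0 n : (0 < 1 / (2 ^ n.+1)%:R :> R)%R by rewrite divr_gt0// ltr0n expn_gt0.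
  have /choice[V VP] : forall n, exists V : set Z,
      [/\ open V, F n `<=` V & m0 V <= m0 (F n) + (1 / (2 ^ n.+1)%:R)%:E].
    by move=> n; exact: approx.
  apply: nU; exists (\bigcup_n V n); split.
  + by apply: bigcup_open => n _; have [] := VP n.
  + by move=> x [n _ Fx]; exists n => //; have [_ + _] := VP n; exact.
  + have mV n : borel_set Z (V n) by apply: open_borel; have [] := VP n.
    apply: (@le_lt_trans _ _ (\sum_(n <oo) m0 (V n))).
      apply: measure_sigma_subadditive => //; exact: bigcupT_measurable.
    apply: (@le_lt_trans _ _ (\sum_(n <oo) (m0 (F n) + (1 / (2 ^ n.+1)%:R)%:E))).
      by apply: lee_nneseries => // n _; have [] := VP n.
    apply: le_lt_trans (epsilon_trick _ _ _) _ => //.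
    by rewrite lte_add_pinfty// ltry.
exists mu; last by move=> A /fE <-; rewrite muE.
have finK (K : set Z) : compact K -> fin K.
  move=> cK; have [U KU [oU fU]] : exists2 U, K `<=` U & open U /\ m0 U < +oo.
    apply: (compact_absorb cK); first by split; [exact: open0|rewrite measure0].
    - move=> A B [oA fA] [oB fB]; split; first exact: openU.
      have [mA mB] := (open_borel oA, open_borel oB).
      by rewrite (le_lt_trans (measureU2 _ _ _))// lte_add_pinfty.
    - by move=> x _; have [U [oU Ux fU]] := m0loc x; exists U.
  by exists U.
split.
- move=> K cK; rewrite muE fE; last exact: finK.
  have [U [oU KU fU]] := finK _ cK; apply: le_lt_trans fU.
  by apply: le_measure; rewrite ?inE; [exact: compact_borel|exact: open_borel|].
- move=> A mA; apply/eqP; rewrite eq_le; apply/andP; split.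
    apply: le_ereal_inf_tmp => _ [U [oU AU] <-].
    by apply: le_measure; rewrite ?inE//; exact: open_borel.
  rewrite muE; have [finA|nA] := pselect (fin A); last by rewrite fN ?leey.
  rewrite fE//; apply/lee_addgt0Pr => e e0.
  have [V [oV AV Vle]] := approx _ _ mA finA e0.
  by apply: ge_ereal_inf; exists (f V); [exists V|rewrite fopen].
- move=> U oU; apply/eqP; rewrite eq_le; apply/andP; split; last first.
    apply: ge_ereal_sup => _ [K [cK KU] <-].
    by apply: le_measure; rewrite ?inE//; [exact: compact_borel|exact: open_borel].
  rewrite {1}muE fopen//; apply: (le_trans (m0inn _ (open_borel oU))).
  apply: ge_ereal_sup => _ [K [cK KU] <-]; apply: le_ereal_sup_tmp.
  by exists (mu K); [exists K|rewrite muE fE//; exact: finK].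
Qed.

End Regularization.

(** * Gluing measures defined on small sets *)

Section Gluing.
Context (R : realType) (Z : ptopologicalType).
Context (small : set (set Z)) (m : set Z -> \bar R).
Hypothesis small_borel : forall A, small A -> borel_set Z A.
Hypothesis small_sub :
  forall A B, small A -> borel_set Z B -> B `<=` A -> small B.
Hypothesis m_measure : forall A, small A -> exists nu : borel_measure R Z,
  forall B, borel_set Z B -> B `<=` A -> m B = nu B.

(** [packing E v] means that [v] is the total mass of finitely many disjoint small
    subsets of [E]. Deriving these sums one set at a time replaces lists of
    disjoint sets by a plain induction. *)
Inductive packing : set Z -> \bar R -> Prop :=
| packing0 E : packing E 0
| packingS A E v :
    small A -> A `<=` E -> packing (E `\` A) v -> packing E (m A + v).

Definition packing_sup (E : set Z) := ereal_sup (packing E).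

Lemma small_mass_ge0 A : small A -> 0 <= m A.
Proof. by move=> sA; have [nu ->//] := m_measure sA; exact: small_borel. Qed.

Lemma packing_ge0 E v : packing E v -> 0 <= v.
Proof. by elim=> // A E' v' sA _ _ v0; rewrite adde_ge0// small_mass_ge0. Qed.

Lemma packing_mono E E' v : E `<=` E' -> packing E v -> packing E' v.
Proof.
move=> + Ev; elim: Ev E' => [E0 E' _|A E0 v0 sA AE _ IH E' EE']; first exact: packing0.
by apply: packingS => //; [move=> x /AE/EE'|apply: IH; exact: setSD].
Qed.

Lemma packing_add E1 E2 v1 v2 : E1 `&` E2 = set0 ->
  packing E1 v1 -> packing E2 v2 -> packing (E1 `|` E2) (v1 + v2).
Proof.
move=> + P1; elim: P1 E2 v2 => [E0|A E0 v0 sA AE _ IH] E2 v2 E12 P2.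
  by rewrite add0e; apply: packing_mono P2 => x; right.
rewrite -addeA; apply: packingS => //; first by move=> x /AE; left.
apply: packing_mono (IH _ _ _ P2).
  move=> x [[Ex nAx]|E2x]; split => //; [by left|by right|].
  by move=> /AE Ex; have : (E0 `&` E2) x by []; rewrite E12.
by rewrite setIC setIDA setIC E12 set0D.
Qed.

Lemma packing_sup_ge0 E : 0 <= packing_sup E.
Proof. by apply: ereal_sup_ubound; exact: packing0. Qed.

Lemma packing_sup_mono E E' : E `<=` E' -> packing_sup E <= packing_sup E'.
Proof. by move=> EE'; apply: ereal_sup_le => v; exact: packing_mono. Qed.

Lemma packing_sup_add E1 E2 : E1 `&` E2 = set0 ->
  packing_sup E1 + packing_sup E2 <= packing_sup (E1 `|` E2).
Proof.
move=> E12; apply: ereal_sup_add_le.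
- by exists 0; exact: packing0.
- by exists 0; exact: packing0.
- by move=> v; exact: packing_ge0.
- by move=> v; exact: packing_ge0.
- by move=> v1 v2 P1 P2; apply: ereal_sup_ubound; exact: packing_add.
Qed.

Lemma packing_sup_small A : small A -> packing_sup A = m A.
Proof.
move=> sA; apply/eqP; rewrite eq_le; apply/andP; split; last first.
  apply: ereal_sup_ubound; rewrite -[m A]adde0; apply: packingS => //.
  exact: packing0.
apply: ge_ereal_sup => v P; elim: P sA => [E sE|B E v' sB BE _ IH sE].
  exact: small_mass_ge0.
have [mE mB] := (small_borel sE, small_borel sB).
have mEB : borel_set Z (E `\` B) by exact: measurableD.
apply: (@le_trans _ _ (m B + m (E `\` B))).
  by rewrite leeD2l// IH//; exact: small_sub sE _ _.
have [nu nuE] := m_measure sE.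
rewrite !nuE//.
rewrite (measureDI nu mE mB) addeC leeD2l//.
by have -> : E `&` B = B by rewrite setIC; exact/setIidPl.
Qed.

(** A packing of the union is cut by the [F n] into one packing of each, and the
    sums are exchanged by induction on the packing; conversely, packings of the
    first [n] sets add up. *)
Lemma packing_sup_bigcup (F : nat -> set Z) : (forall n, borel_set Z (F n)) ->
  trivIset setT F ->
  packing_sup (\bigcup_n F n) = \sum_(n <oo) packing_sup (F n).
Proof.
move=> mF tF; apply/eqP; rewrite eq_le; apply/andP; split.
  apply: ge_ereal_sup => v; move EF : (\bigcup_n F n) => E P.
  elim: P F mF tF EF => [E' F mF tF _|A E' v' sA AE _ IH F mF tF EF].
    by apply: nneseries_ge0 => n _ _; exact: packing_sup_ge0.
  have mA := small_borel sA.
  have mFA n : borel_set Z (F n `\` A) by exact: measurableD.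
  have mAF n : borel_set Z (A `&` F n) by exact: measurableI.
  have sAF n : small (A `&` F n) by apply: small_sub sA _ _ => // x [].
  have tFA : trivIset setT (fun n => F n `\` A).
    by move=> i j _ _ [x [[Fi _] [Fj _]]]; apply: tF => //; exists x.
  have tAF : trivIset setT (fun n => A `&` F n).
    by move=> i j _ _ [x [[_ Fi] [_ Fj]]]; apply: tF => //; exists x.
  have le2 : v' <= \sum_(n <oo) packing_sup (F n `\` A).
    by apply: IH => //; rewrite -EF -setD_bigcupl.
  have -> : m A = \sum_(n <oo) m (A `&` F n).
    have [nu nuE] := m_measure sA.
    rewrite nuE// {1}(_ : A = \bigcup_n (A `&` F n)).
      rewrite measure_semi_bigcup//; last exact: bigcupT_measurable.
      by apply: eq_eseriesr => n _; rewrite nuE// => x [].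
    by rewrite -setI_bigcupr EF; apply/esym/setIidPl.
  apply: (le_trans (leeD2l _ le2)).
  rewrite -nneseriesD//; last by move=> n _ _; exact: packing_sup_ge0.
    apply: lee_nneseries => n _ //.
      by rewrite adde_ge0 ?small_mass_ge0 ?packing_sup_ge0.
    rewrite -packing_sup_small//.
    apply: (le_trans (packing_sup_add _)); last first.
      by apply: packing_sup_mono => x [[]|[]].
    by apply/seteqP; split => // x [[Ax _] []].
  by move=> n _ _; exact: small_mass_ge0.
apply: lime_le; first by apply: is_cvg_nneseries => n _ _; exact: packing_sup_ge0.
apply: nearW => n; rewrite big_mkord.
apply: (@le_trans _ _ (packing_sup (\big[setU/set0]_(i < n) F i))); last first.
  by apply: packing_sup_mono; rewrite -bigcup_mkord => x [i _ Fx]; exists i.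
elim: n => [|n IH]; first by rewrite !big_ord0 packing_sup_ge0.
rewrite !big_ord_recr /=; apply: (le_trans (leeD2r _ IH)).
apply: packing_sup_add; rewrite -bigcup_mkord -subset0 => x [[i /= iltn Fi] Fn].
by have /eqP := tF i n Logic.I Logic.I (ex_intro _ x (conj Fi Fn)); rewrite ltn_eqF.
Qed.

(** By the last clause the glued measure is the least superadditive set function
    that dominates [m] on the small sets. This is how inner regularity is proved:
    take for [g A] the supremum of the masses of the compact subsets of [A]. *)
Lemma glue_measures : exists2 m0 : borel_measure R Z,
  forall A, small A -> m0 A = m A &
  forall g : set Z -> \bar R, (forall A, 0 <= g A) ->
    (forall A, small A -> m A <= g A) ->
    (forall A B, borel_set Z A -> borel_set Z B -> A `&` B = set0 ->
      g A + g B <= g (A `|` B)) ->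
    forall E, borel_set Z E -> m0 E <= g E.
Proof.
have [|||m0 m0E] := @borel_measureP R Z packing_sup.
- apply/eqP; rewrite eq_le packing_sup_ge0 andbT.
  apply: ge_ereal_sup => v; move E0 : set0 => E P.
  elim: P E0 => [//|A E' v' sA AE _ IH E0].
  have A0 : A = set0 by apply/seteqP; split => // x /AE; rewrite -E0.
  rewrite A0 in sA *; have [nu ->//] := m_measure sA.
  by rewrite measure0 add0e IH// A0 -E0 setD0.
- exact: packing_sup_ge0.
- exact: packing_sup_bigcup.
exists m0; first by move=> A sA; rewrite m0E packing_sup_small.
move=> g g0 mg gadd E mE; rewrite m0E; apply: ge_ereal_sup => v P.
elim: P mE => [//|A E' v' sA AE _ IH mE].
have mA := small_borel sA.
have mEA : borel_set Z (E' `\` A) by exact: measurableD.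
apply: (@le_trans _ _ (g A + g (E' `\` A))); first by rewrite leeD ?mg ?IH.
have EE : A `|` (E' `\` A) = E'.
  apply/seteqP; split => [x [/AE//|[]//]|x Ex].
  by have [Ax|nAx] := pselect (A x); [left|right].
rewrite -[X in _ <= g X]EE; apply: gadd => //.
by apply/seteqP; split => // x [Ax []].
Qed.

End Gluing.

Lemma pullback_measure (R : realType) (X Z : ptopologicalType)
    (theta : X -> Z -> Prop) (rho : borel_measure R X) : partial_homeo theta ->
  exists nu : borel_measure R Z,
    forall B, nu B = rho (rimage (rinv theta) B).
Proof.
move=> ht; have hi := partial_homeo_inv ht.
have [|||nu nuE] := @borel_measureP R Z (fun B => rho (rimage (rinv theta) B)).
- rewrite -(measure0 rho); congr (rho _).
  by apply/seteqP; split => // x [].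
- by [].
- move=> F mF tF; rewrite rimage_bigcup measure_semi_bigcup//.
  + by move=> n; exact: rimage_borel.
  + exact: rimage_trivIset.
  + by apply: bigcupT_measurable => n; exact: rimage_borel.
by exists nu => B; rewrite nuE.
Qed.

(** The small sets are those inside an open set of finite measure in the range of
    some [theta i]; the pullbacks of [rho] give their masses. The resulting measure
    is inner regular because [rho] is, and its regularization is transported
    from [rho] near each point of each domain. *)
Lemma glue_radon (R : realType) (X Z : ptopologicalType) (I : Type)
    (theta : I -> X -> Z -> Prop) (rho : borel_measure R X) :
  hausdorff_space X -> hausdorff_space Z -> radon rho ->
  (forall i, partial_homeo (theta i)) ->
  (forall z, exists i, rdom (rinv (theta i)) z) ->
  (forall i j E, borel_set Z E -> E `<=` rdom (rinv (theta i)) ->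
    E `<=` rdom (rinv (theta j)) ->
    rho (rimage (rinv (theta i)) E) = rho (rimage (rinv (theta j)) E)) ->
  exists2 mu : borel_measure R Z, radon mu &
    forall i, transports_to (theta i) rho mu.
Proof.
move=> hX hZ rrho ht cov compat.
have hi i := partial_homeo_inv (ht i).
pose patch i (U : set Z) := [/\ open U, U `<=` rdom (rinv (theta i)) &
  rho (rimage (rinv (theta i)) U) < +oo].
pose small (A : set Z) := borel_set Z A /\ exists i U, patch i U /\ A `<=` U.
(* By compatibility this is the supremum of a single value. *)
pose m (A : set Z) := ereal_sup [set rho (rimage (rinv (theta i)) A) | i in
  [set i | A `<=` rdom (rinv (theta i))]].
have mE i A : borel_set Z A -> A `<=` rdom (rinv (theta i)) ->
    m A = rho (rimage (rinv (theta i)) A).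
  move=> mA Ai; apply/eqP; rewrite eq_le; apply/andP; split.
    by apply: ge_ereal_sup => _ [j Aj <-]; rewrite (compat i j).
  by apply: ereal_sup_ubound; exists i.
have small_sub A B : small A -> borel_set Z B -> B `<=` A -> small B.
  move=> [mA [i [U [pU AU]]]] mB BA; split => //; exists i, U; split => //.
  exact: subset_trans AU.
have patchP i x : rdom (theta i) x -> exists N : set X,
    [/\ open N, N x, N `<=` rdom (theta i) & patch i (rimage (theta i) N)].
  move=> ix; have [U [oU Ux fU]] := radon_nbhs_finite hX x rrho.
  have oN : open (U `&` rdom (theta i)) by exact: openI oU (open_rdom (ht i)).
  have Nd : U `&` rdom (theta i) `<=` rdom (theta i) by move=> y [].
  exists (U `&` rdom (theta i)); split => //; split.
  - exact: phomeo_open (ht i) _ oN.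
  - exact: rimage_rdom.
  - rewrite (rimageK (ht i) Nd); apply: le_lt_trans fU.
    by apply: le_measure; rewrite ?inE; [exact: open_borel|exact: open_borel|move=> y []].
have [|||m0 m0E m0min] := @glue_measures R Z small m.
- by move=> A [].
- exact: small_sub.
- move=> A [mA [i [U [[oU Ui fU] AU]]]].
  have [nu nuE] := pullback_measure rho (ht i).
  exists nu => B mB BA; rewrite nuE (mE i)//.
  by move=> z /BA/AU/Ui.
have m0patch i U : patch i U -> m0 U = rho (rimage (rinv (theta i)) U).
  move=> pU; have [oU Ui fU] := pU; have mU := open_borel oU.
  by rewrite m0E ?(mE i)//; split => //; exists i, U; split.
have [|z|E mE'|mu rmu muE] := @radon_regularization R Z m0.
- exact: hZ.
- have [i [x xz]] := cov z.
  have [N [oN Nx Nd pN]] : exists N : set X,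
    [/\ open N, N x, N `<=` rdom (theta i) & patch i (rimage (theta i) N)].
    by apply: patchP; exists z.
  exists (rimage (theta i) N); split; first by case: pN.
    by exists x.
  by rewrite (m0patch _ _ pN); case: pN.
- pose g (A : set Z) :=
    ereal_sup [set m0 K | K in [set K : set Z | compact K /\ K `<=` A]].
  apply: (m0min g) => //.
  + move=> A; apply: ereal_sup_ubound; exists set0; last exact: measure0.
    by split => //; exact: compact0.
  + move=> A sA; have [mA [i [U [[oU Ui fU] AU]]]] := sA.
    have Ai : A `<=` rdom (rinv (theta i)) by move=> z /AU/Ui.
    have mA' := rimage_borel (hi i) mA.
    have mU' := rimage_borel (hi i) (open_borel oU).
    rewrite (mE i)//; apply: le_trans (radon_inner hX rrho mA' _) _.
      apply: le_lt_trans fU; apply: le_measure; rewrite ?inE//.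
      exact: rimage_sub.
    apply: ge_ereal_sup => _ [K [cK KA] <-].
    have Kd : K `<=` rdom (theta i) by move=> x /KA[z _ xz]; exists z.
    have cK' := rimage_compact (ht i) cK Kd.
    have KA' : rimage (theta i) K `<=` A.
      by rewrite -(rimageK (hi i) Ai); exact: rimage_sub.
    have mK' := compact_borel hZ cK'.
    apply: ereal_sup_ubound; exists (rimage (theta i) K) => //.
    rewrite m0E; last exact: small_sub sA mK' KA'.
    rewrite (mE i)//; last exact: rimage_rdom.
    by rewrite (rimageK (ht i) Kd).
  + move=> A B mA mB AB; apply: ereal_sup_add_le.
    * by exists (m0 set0), set0 => //; split => //; exact: compact0.
    * by exists (m0 set0), set0 => //; split => //; exact: compact0.
    * by move=> _ [K _ <-] /=.
    * by move=> _ [K _ <-] /=.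
    * move=> _ _ [K [cK KA] <-] [L [cL LB] <-].
      have [mK mL] := (compact_borel hZ cK, compact_borel hZ cL).
      apply: ereal_sup_ubound; exists (K `|` L).
        by split; [exact: compactU|move=> x [/KA|/LB]; [left|right]].
      apply: measureU => //; apply/seteqP; split => // x [/KA Ax /LB Bx].
      by rewrite -AB.
exists mu => // i; apply: (transports_local hX hZ rrho rmu (ht i)) => x ix.
have [N [oN Nx Nd pN]] := patchP i x ix.
exists N; split => // A mA AN Ad; have mA' := rimage_borel (ht i) mA.
have AN' : rimage (theta i) A `<=` rimage (theta i) N by exact: rimage_sub.
rewrite muE; last first.
  exists (rimage (theta i) N); split => //; first by case: pN.
  by rewrite (m0patch _ _ pN); case: pN.
rewrite m0E; last by split => //; exists i, (rimage (theta i) N); split.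
rewrite (mE i)//; last exact: rimage_rdom.
by rewrite (rimageK (ht i) Ad).
Qed.

(** * Translations by open bisections *)

Lemma ginvK (G : etale_groupoid) (g : G) : ginv (ginv g) = g.
Proof.
have := @gmulA G (ginv (ginv g)) (ginv g) g.
rewrite !src_ginv rng_ginv => /(_ erefl erefl).
rewrite gmul_ginvl -[X in unit_arrow X]rng_ginv -src_ginv gmul_unitr => ->.
by rewrite gmul_ginvl src_ginv gmul_unitl.
Qed.

Lemma open_bisection_ginv (G : etale_groupoid) (U : set G) :
  open_bisection U -> open_bisection (@ginv G @^-1` U).
Proof.
move=> [oU sU rU]; split.
- by apply: open_comp => // g _; exact: ginv_continuous.
- move=> g h; rewrite !inE => Ug Uh gh.
  rewrite -[g]ginvK -[h]ginvK; congr ginv.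
  by apply: rU; rewrite ?inE// !rng_ginv.
- move=> g h; rewrite !inE => Ug Uh gh.
  rewrite -[g]ginvK -[h]ginvK; congr ginv.
  by apply: sU; rewrite ?inE// !src_ginv.
Qed.

Lemma exists_bisection (G : etale_groupoid) (g : G) :
  exists2 U : set G, open_bisection U & U g.
Proof.
have [U [oU Ug iU _ _]] := src_local_homeomorphism g.
have [V [oV Vg iV _ _]] := rng_local_homeomorphism g.
exists (U `&` V) => //; split; first exact: openI.
- by move=> x y; rewrite !inE => -[Ux _] [Uy _]; apply: iU; rewrite inE.
- by move=> x y; rewrite !inE => -[_ Vx] [_ Vy]; apply: iV; rewrite inE.
Qed.

(** Common to left and right actions: an arrow that translates [x] into [O] can be
    moved along with [x], since [tgt] is open near it. *)
Lemma open_translation_preimage (A B T : topologicalType) (tgt : A -> B)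
    (anchor : T -> B) (act : T -> A -> T) (V : set A) (O : set T) :
  local_homeomorphism tgt -> continuous anchor ->
  (forall x h, anchor x = tgt h -> forall N, nbhs (act x h) N ->
    exists2 M : set T * set A, nbhs x M.1 /\ nbhs h M.2 &
      forall z k, M.1 z -> M.2 k -> anchor z = tgt k -> N (act z k)) ->
  open V -> open O ->
  open [set x | exists h, [/\ V h, anchor x = tgt h & O (act x h)]].
Proof.
move=> ltgt canchor cact oV oO; rewrite openE => x [h [Vh xh Oxh]].
have [[M N] /= [Mx Nh] MN] := cact x h xh O (open_nbhs_nbhs (conj oO Oxh)).
have [U [oU Uh _ _ Uopen]] := ltgt h.
have oW : open (tgt @` (V `&` N° `&` U)).
  apply: Uopen => [|? []//]; apply: openI => //; apply: openI => //.
  exact: open_interior.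
have : nbhs x (anchor @^-1` (tgt @` (V `&` N° `&` U)) `&` M).
  apply: filterI => //; apply: canchor; apply: open_nbhs_nbhs; split => //.
  by rewrite xh; exists h.
apply: filterS => z [[k [[Vk Nk] _] kz] Mz] /=.
by exists k; split => //; apply: MN => //; exact: interior_subset.
Qed.

Section LeftTranslation.
Context (G : etale_groupoid) (X : topologicalType) (a : left_action G X).

(** Inverses of translations are again translations, which reduces injectivity to
    functionality and openness to continuity. *)
Lemma left_translation_inv (U : set G) :
  left_translation a (@ginv G @^-1` U) = rinv (left_translation a U).
Proof.
have H (V : set G) x y : left_translation a (@ginv G @^-1` V) x y ->
    left_translation a V y x.
  move=> [g [Vg gx ->]]; exists (ginv g); split => //.
    by rewrite src_ginv lanchor_act.
  by rewrite -lact_gmul ?src_ginv// gmul_ginvl gx lact_unit.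
apply/funext => x; apply/funext => y; apply/propext; split; first exact: H.
move=> yx; apply: H; suff -> : @ginv G @^-1` (@ginv G @^-1` U) = U by [].
by apply/funext => g; rewrite /preimage /= /mkset ginvK.
Qed.

Lemma left_translation_homeo (U : set G) : open_bisection U ->
  partial_homeo (left_translation a U).
Proof.
have func V : open_bisection V ->
    forall x y y', left_translation a V x y -> left_translation a V x y' -> y = y'.
  move=> [_ sV _] x y y' [g [Vg gx ->]] [h [Vh hx ->]].
  by congr lact; apply: sV; rewrite ?inE// gx hx.
have cont V : open_bisection V ->
    forall O, open O -> open (rimage (rinv (left_translation a V)) O).
  move=> [oV _ _] O oO.
  rewrite [X in open X](_ : _ =
      [set x | exists g, [/\ V g, lanchor a x = src g & O (lact a g x)]]).
    apply: (@open_translation_preimage _ _ _ _ _ (fun x g => lact a g x)) => //.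
    - exact: src_local_homeomorphism.
    - exact: lanchor_continuous.
    - move=> x g xg N Ngx.
      have /subspace_continuousP/(_ (g, x) (esym xg) N Ngx) := lact_continuous (l := a).
      rewrite /nbhs /= /within => -[[P Q] /= [Pg Qx] PQN].
      by exists (Q, P) => //= z k Qz Pk zk; exact: (PQN (k, z)).
  apply/seteqP; split=> [x [y Oy [g [Vg gx yE]]]|x [g [Vg gx Og]]].
    by exists g; split => //; rewrite -yE.
  by exists (lact a g x) => //; exists g.
move=> bU; have bU' := open_bisection_ginv bU.
split.
- exact: func.
- by move=> x x' y xy x'y; apply: (func _ bU' y); rewrite left_translation_inv.
- by move=> O oO; have := cont _ bU' _ oO; rewrite left_translation_inv.
- exact: cont.
Qed.

End LeftTranslation.

Section RightTranslation.
Context (H : etale_groupoid) (X : topologicalType) (a : right_action H X).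

Lemma right_translation_inv (V : set H) :
  right_translation a (@ginv H @^-1` V) = rinv (right_translation a V).
Proof.
have K (W : set H) x y : right_translation a (@ginv H @^-1` W) x y ->
    right_translation a W y x.
  move=> [h [Wh hx ->]]; exists (ginv h); split => //.
    by rewrite rng_ginv ranchor_act.
  by rewrite -ract_gmul ?rng_ginv// gmul_ginvr -hx ract_unit.
apply/funext => x; apply/funext => y; apply/propext; split; first exact: K.
move=> yx; apply: K; suff -> : @ginv H @^-1` (@ginv H @^-1` V) = V by [].
by apply/funext => g; rewrite /preimage /= /mkset ginvK.
Qed.

Lemma right_translation_homeo (V : set H) : open_bisection V ->
  partial_homeo (right_translation a V).
Proof.
have func W : open_bisection W ->
    forall x y y', right_translation a W x y -> right_translation a W x y' -> y = y'.
  move=> [_ _ rW] x y y' [g [Wg gx ->]] [h [Wh hx ->]].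
  by congr ract; apply: rW; rewrite ?inE// -gx -hx.
have cont W : open_bisection W ->
    forall O, open O -> open (rimage (rinv (right_translation a W)) O).
  move=> [oW _ _] O oO.
  rewrite [X in open X](_ : _ =
      [set x | exists g, [/\ W g, ranchor a x = rng g & O (ract a x g)]]).
    apply: open_translation_preimage => //.
    - exact: rng_local_homeomorphism.
    - exact: ranchor_continuous.
    - move=> x g xg N Ngx.
      have /subspace_continuousP/(_ (x, g) xg N Ngx) := ract_continuous (r := a).
      rewrite /nbhs /= /within => -[[P Q] /= [Pg Qx] PQN].
      by exists (P, Q) => //= z k Qz Pk zk; exact: (PQN (z, k)).
  apply/seteqP; split=> [x [y Oy [g [Vg gx yE]]]|x [g [Vg gx Og]]].
    by exists g; split => //; rewrite -yE.
  by exists (ract a x g) => //; exists g.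
move=> bV; have bV' := open_bisection_ginv bV.
split.
- exact: func.
- by move=> x x' y xy x'y; apply: (func _ bV' y); rewrite right_translation_inv.
- by move=> O oO; have := cont _ bV' _ oO; rewrite right_translation_inv.
- exact: cont.
Qed.

End RightTranslation.

Lemma nbhs_setM (S T : topologicalType) (x : S) (y : T) M N :
  nbhs x M -> nbhs y N -> nbhs (x, y) (M `*` N).
Proof. by move=> xM yN; exists (M, N). Qed.

(** * Orbit spaces of free and proper actions *)

Section FreeProper.
Context (G : etale_groupoid) (X : topologicalType) (a : left_action G X).
Hypotheses (hX : hausdorff_space X) (lcX : locally_compact [set: X]).
Hypotheses (pa : lproper a).

Lemma compact_nbhs (x : X) : exists2 K : set X, nbhs x K & compact K.
Proof.
have [K xK [cK _]] : compact_near (within [set: X] (nbhs x)) by exact: lcX.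
exists K => //; suff : \forall y \near x, [set: X] y -> K y by apply: filterS => y; exact.
exact: xK.
Qed.

Lemma separate (x y : X) : x <> y ->
  exists A B : set X, [/\ nbhs x A, nbhs y B & forall z, A z -> B z -> False].
Proof.
move=> /eqP xy; move: hX; rewrite open_hausdorff => /(_ _ _ xy).
move=> [[A B] /=]; rewrite !inE => -[Ax By] [oA oB AB].
exists A, B; split; [exact: open_nbhs_nbhs|exact: open_nbhs_nbhs|].
by move=> z Az Bz; have : (A `&` B) z by []; rewrite AB.
Qed.

(** Properness in the form used below: over a compact neighbourhood of [(x', x)]
    only a compact set of pairs [(g, z)] matters, so that arrows taking points near
    [x] to points near [x'] are close to those taking [x] to [x']. *)
Lemma lproper_near x x' (O : set G) : open O ->
  (forall g, src g = lanchor a x -> lact a g x = x' -> O g) ->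
  exists N N' : set X, [/\ open N, N x, open N', N' x' &
    forall g z, src g = lanchor a z -> N z -> N' (lact a g z) -> O g].
Proof.
move=> oO xx'; have [K xK cK] := compact_nbhs x.
have [K' xK' cK'] := compact_nbhs x'.
have /compact_near_coveringP := pa (compact_setX cK' cK).
pose P (w : X * X) (p : G * X) := src p.1 = lanchor a p.2 ->
  lact a p.1 p.2 = w.1 -> p.2 = w.2 -> O p.1.
move=> /(_ _ (nbhs (x', x)) P _) [].
  move=> [g z] [/= gz _].
  have [zx|zx] := pselect (z = x); last first.
    have [A [B [Az Bx AB]]] := separate zx.
    exists ([set p : G * X | A p.2], [set w : X * X | B w.2]) => /=.
      split.
        by apply: filterS (nbhs_setM filterT Az) => ? [].
      by apply: filterS (nbhs_setM filterT Bx) => ? [].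
    by move=> [[h y] [w' w]] /= [Ay Bw] _ _ /= yw; case: (AB y Ay); rewrite yw.
  subst z; have [gx|gx] := pselect (lact a g x = x').
    exists ([set p : G * X | O p.1], setT) => /=; last by move=> [[h y] w] /= [Oh _] _ _ _.
    split; last exact: filterT.
    suff Og : nbhs g O by apply: filterS (nbhs_setM Og filterT) => ? [].
    by apply: open_nbhs_nbhs; split => //; exact: xx'.
  have [A [B [Ag Bx AB]]] := separate gx.
  have /subspace_continuousP/(_ (g, x) gz A Ag) := lact_continuous (l := a).
  rewrite /nbhs /= /within => H.
  exists ([set p : G * X | src p.1 = lanchor a p.2 -> A (lact a p.1 p.2)],
          [set w : X * X | B w.1]) => /=.
    by split => //; apply: filterS (nbhs_setM Bx filterT) => ? [].
  by move=> [[h y] [w' w]] /= [Ah Bw] hy /= hw _; case: (AB w') => //; rewrite -hw; exact: Ah.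
move=> [M' M] /= [M'x Mx] MP.
exists (M `&` K)°, (M' `&` K')°; split.
- exact: open_interior.
- exact: filterI.
- exact: open_interior.
- exact: filterI.
move=> g z gz /interior_subset[Mz Kz] /interior_subset[Mg Kg].
by apply: (MP (lact a g z, z) _ (g, z)).
Qed.

(** By freeness only a unit fixes [x], and the units are open in an étale groupoid:
    an arrow between points near [x] is then itself a unit. *)
Lemma orbit_map_locally_inj x : lfree a ->
  exists W : set X, [/\ open W, W x & set_inj W (orbit_map a)].
Proof.
move=> fa; have [U [oU Ux iU _ _]] := src_local_homeomorphism (unit_arrow (lanchor a x)).
have [|N [N' [oN Nx oN' Nx' NN']]] := @lproper_near x x U oU.
  by move=> g gx gxx; rewrite (fa _ _ gx gxx).
exists (N `&` N' `&` [set z | U (unit_arrow (lanchor a z))]); split => //.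
  apply: openI; first exact: openI.
  apply: open_comp => // z _; apply: continuous_comp.
    exact: lanchor_continuous.
  exact: unit_arrow_continuous.
move=> z z'; rewrite !inE => -[[Nz _] Uz] [[_ Nz'] _] /orbit_mapP[g gz gzz'].
have Ug : U g by apply: (NN' g z) => //; rewrite gzz'.
rewrite -gzz' (_ : g = unit_arrow (lanchor a z)) ?lact_unit//.
by apply: iU; rewrite ?inE// src_unit.
Qed.

(** For points of distinct orbits [lproper_near] applies with the empty set of
    arrows, so they have neighbourhoods that no arrow connects. *)
Lemma orbit_space_hausdorff : hausdorff_space (orbit_space a).
Proof.
rewrite open_hausdorff => y y' yy'.
have yE (z : orbit_space a) : orbit_map a (repr z) = z by rewrite /orbit_map reprK.
have [|N [N' [oN Nx oN' Nx' NN']]] := @lproper_near (repr y) (repr y') set0 open0.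
  move=> g gx gxx; have : orbit_map a (repr y) = orbit_map a (repr y').
    by apply/orbit_mapP; exists g.
  by rewrite !yE => E; rewrite E eqxx in yy'.
exists (orbit_map a @` N, orbit_map a @` N') => /=.
  by rewrite !inE; split; [exists (repr y)|exists (repr y')].
split; [exact: orbit_map_open|exact: orbit_map_open|].
apply/eqP/seteqP; split => // _ [[z Nz <-] [z' Nz' /esym/orbit_mapP[g gz gzz']]].
by apply: (NN' g z) => //; rewrite gzz'.
Qed.

End FreeProper.

(** * The correspondence of measures *)

Section Correspondence.
Context (R : realType) (G : etale_groupoid) (X : ptopologicalType)
  (a : left_action G X).
Hypotheses (hX : hausdorff_space X) (lcX : locally_compact [set: X]).
Hypotheses (fa : lfree a) (pa : lproper a).

Let Y : ptopologicalType := orbit_space a.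
Let q : X -> Y := orbit_map a.
Let hY : hausdorff_space Y := orbit_space_hausdorff hX lcX pa.

Definition section_domain (W : set X) := open W /\ set_inj W (orbit_map a).

Definition chart (W : set X) (x : X) (y : orbit_space a) : Prop :=
  W x /\ orbit_map a x = y.

Definition quotient_of (rho : borel_measure R X)
    (mu : borel_measure R (orbit_space a)) :=
  forall W, section_domain W -> transports_to (chart W) rho mu.

Lemma exists_section_domain x : exists2 W, section_domain W & W x.
Proof. by have [W [oW Wx iW]] := orbit_map_locally_inj hX lcX pa x fa; exists W. Qed.

Lemma section_domainI W O : section_domain W -> open O -> section_domain (W `&` O).
Proof.
move=> [oW iW] oO; split; first exact: openI.
by move=> x y; rewrite !inE => -[Wx _] [Wy _]; apply: iW; rewrite inE.
Qed.

Lemma rimage_chart W A : A `<=` W -> rimage (chart W) A = q @` A.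
Proof.
move=> AW; apply/seteqP; split=> [y [x Ax [Wx <-]]|_ [x Ax <-]]; first by exists x.
by exists x => //; split => //; exact: AW.
Qed.

Lemma rdom_chart W : rdom (chart W) = W.
Proof. by apply/seteqP; split=> [x [y [Wx _]]|x Wx] //; exists (q x). Qed.

Lemma chart_homeo W : section_domain W -> partial_homeo (chart W).
Proof.
move=> [oW iW]; split.
- by move=> x y y' [_ <-] [_ <-].
- by move=> x x' y [Wx <-] [Wx' xx']; apply: iW; rewrite ?inE.
- move=> U oU; rewrite [X in open X](_ : _ = q @` (U `&` W)).
    by apply: orbit_map_open; exact: openI.
  apply/seteqP; split=> [y [x Ux [Wx <-]]|_ [x [Ux Wx] <-]]; by exists x.
- move=> V oV; rewrite [X in open X](_ : _ = W `&` q @^-1` V).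
    apply: openI => //; apply: open_comp => // x _; exact: orbit_map_continuous.
  by apply/seteqP; split=> [x [y Vy [Wx qx]]|x [Wx Vx]];
    [rewrite -qx in Vy|exists (q x)].
Qed.

Lemma left_translation_orbit U x y : left_translation a U x y -> q x = q y.
Proof. by move=> [g [_ gx ->]]; apply/orbit_mapP; exists g. Qed.

(** Both sides measure lifts of [E] to [X]. The lifts are related by the partial
    homeomorphism [theta], which follows the orbits from [W] to [W'] and coincides
    near each point with the translation by an open bisection, where invariance
    applies. *)
Lemma invariant_chart (rho : borel_measure R X) W W' E :
  invariant_radon a rho -> section_domain W -> section_domain W' ->
  borel_set Y E -> E `<=` q @` W -> E `<=` q @` W' ->
  rho (rimage (rinv (chart W)) E) = rho (rimage (rinv (chart W')) E).
Proof.
move=> [rrho irho] sW sW' mE EW EW'.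
have [oW iW] := sW; have [oW' iW'] := sW'.
pose theta x x' := [/\ W x, W' x' & q x = q x'].
have htheta : partial_homeo theta.
  have opn V V' : section_domain V -> section_domain V' ->
      forall O, open O ->
      open (rimage (fun x x' => [/\ V x, V' x' & q x = q x']) O).
    move=> sV sV' O oO; have [oV _] := sV.
    have := phomeo_continuous (chart_homeo sV') (orbit_map_open a (openI oO oV)).
    congr open; apply/seteqP; split.
      by move=> x [_ [z [Oz Vz] <-] [V'x xz]]; exists z => //; split.
    by move=> x [z Oz [Vz V'x zx]]; exists (q z); [exists z|split].
  split.
  - move=> x y y' [_ W'y xy] [_ W'y' xy'].
    by apply: iW'; rewrite ?inE// -[LHS]xy.
  - move=> x x' y [Wx _ xy] [Wx' _ x'y].
    by apply: iW; rewrite ?inE// [LHS]xy.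
  - exact: opn.
  - move=> O oO; have := opn _ _ sW' sW O oO; congr open.
    by apply/seteqP; split=> x [y Oy [? ? xy]]; exists y.
have tr : transports_to theta rho rho.
  apply: (transports_local hX hX rrho rrho htheta) => x [x' [Wx W'x' /orbit_mapP[g gx gxx']]].
  have [U bU Ug] := exists_bisection g.
  have hU := left_translation_homeo a bU.
  exists (W `&` rimage (rinv (left_translation a U)) W'); split.
  - exact/openI/(phomeo_continuous hU).
  - by split => //; exists x' => //; exists g.
  - move=> A mA AN _.
    rewrite -(irho _ bU A mA); last by move=> z /AN[_ [z' _ zz']]; exists z'.
    congr (rho _); apply/seteqP; split.
      move=> y [z Az [Wz W'y zy]]; exists z => //.
      have [_ [z' W'z' zz']] := AN _ Az.
      rewrite (_ : y = z')//; apply: iW'; rewrite ?inE//.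
      exact: etrans (esym zy) (left_translation_orbit zz').
    move=> y [z Az zy]; exists z => //; have [Wz [z' W'z' zz']] := AN _ Az.
    split => //; first by rewrite (phomeo_functional hU zy zz').
    exact: left_translation_orbit zy.
have mA := rimage_borel (partial_homeo_inv (chart_homeo sW)) mE.
rewrite -tr; first congr (rho _).
- apply/seteqP; split.
    move=> x [y [z Ez [Wy yz]] [_ W'x yx]]; exists z => //.
    by split => //; rewrite -yz; exact: esym.
  move=> x [z Ez [W'x xz]]; have [y Wy yz] := EW _ Ez.
  exists y; first by exists z.
  by split => //; rewrite [RHS]xz.
- exact: mA.
- move=> x [y Ey [Wx xy]]; have [x' W'x' x'y] := EW' _ Ey.
  by exists x'; split => //; rewrite x'y.
Qed.

Lemma exists_quotient_measure (rho : borel_measure R X) :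
  invariant_radon a rho ->
  exists2 mu : borel_measure R Y, radon mu & quotient_of rho mu.
Proof.
move=> irho; have [rrho _] := irho.
have [||||y|[W sW] [W' sW'] E mE EW EW'|mu rmu mut] :=
  @glue_radon R X Y {W | section_domain W} (fun i => chart (sval i)) rho.
- exact: hX.
- exact: hY.
- exact: rrho.
- by move=> [W sW]; exact: chart_homeo.
- have [W sW Wy] := exists_section_domain (repr y).
  exists (exist _ W sW) => /=; exists (repr y); split => //.
  by rewrite /orbit_map reprK.
- apply: invariant_chart => //.
    by move=> y /EW[x [Wx xy]]; exists x.
  by move=> y /EW'[x [Wx xy]]; exists x.
by exists mu => // W sW; exact: (mut (exist _ W sW)).
Qed.

Section Intertwine.
Context (rho rho' : borel_measure R X) (mu mu' : borel_measure R Y).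
Context (theta : X -> X -> Prop) (theta' : Y -> Y -> Prop).
Hypotheses (rrho : radon rho) (rrho' : radon rho').
Hypotheses (rmu : radon mu) (rmu' : radon mu').
Hypotheses (rhomu : quotient_of rho mu) (rhomu' : quotient_of rho' mu').
Hypotheses (htheta : partial_homeo theta) (htheta' : partial_homeo theta').
Hypothesis semiconj : forall x x', theta x x' -> theta' (q x) (q x').

(** Since [theta'] is injective, [theta] carries a set on which [q] is injective to
    another one. *)
Let adapted x : rdom theta x ->
  exists W, [/\ section_domain W, W x, W `<=` rdom theta &
    section_domain (rimage theta W)].
Proof.
move=> dx; have [W sW Wx] := exists_section_domain x.
have od := open_rdom htheta; have sWd := section_domainI sW od.
exists (W `&` rdom theta); split => //.
have [oWd iWd] := sWd; split; first exact: (phomeo_open htheta).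
move=> z z'; rewrite !inE => -[w wW wz] [w' w'W w'z'] zz'.
have E : w = w'.
  apply: iWd; rewrite ?inE//.
  by apply: (phomeo_injective htheta' (semiconj wz)); rewrite [q z]zz'; exact: semiconj.
by rewrite -E in w'z'; exact: (phomeo_functional htheta wz w'z').
Qed.

Let chart_theta W A : section_domain W -> W `<=` rdom theta -> A `<=` W ->
  rimage (chart (rimage theta W)) (rimage theta A) =
  rimage theta' (rimage (chart W) A).
Proof.
move=> sW Wd AW; apply/seteqP; split=> y.
  move=> [x' [x Ax xx'] [_ <-]]; exists (q x); last exact: semiconj.
  by exists x => //; split => //; exact: AW.
move=> [_ [x Ax [Wx <-]] xy]; have [x' xx'] := Wd _ Wx.
exists x'; first by exists x.
split; first by exists x.
exact: (phomeo_functional htheta' (semiconj xx') xy).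
Qed.

Let measure_theta W A : section_domain W -> section_domain (rimage theta W) ->
  W `<=` rdom theta -> borel_set X A -> A `<=` W ->
  mu' (rimage theta' (rimage (chart W) A)) = rho' (rimage theta A).
Proof.
move=> sW stW Wd mA AW; rewrite -(chart_theta sW Wd AW) rhomu'//.
  exact: rimage_borel.
by rewrite rdom_chart; exact: rimage_sub.
Qed.

(** Over a small [W], both transports compare the same two numbers, by
    [measure_theta]. *)
Lemma transports_lift : transports theta' mu mu' -> transports theta rho rho'.
Proof.
move=> tmu; apply: (transports_local hX hX rrho rrho' htheta) => x dx.
have [W [sW Wx Wd stW]] := adapted dx; have [oW _] := sW.
exists W; split => // A mA AW _; rewrite -(measure_theta sW stW Wd mA AW).
have mA' := rimage_borel (chart_homeo sW) mA.
rewrite (tmu (rimage (chart W) A)).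
- by rewrite (rhomu sW)// rdom_chart.
- exact: mA'.
- move=> y [z Az [Wz <-]]; have [z' zz'] := Wd _ Wz.
  by exists (q z'); exact: semiconj.
Qed.

Hypothesis lifting : forall x y, theta' (q x) y -> rdom theta x.

Lemma transports_descend : transports theta rho rho' -> transports theta' mu mu'.
Proof.
move=> trho; apply: (transports_local hY hY rmu rmu' htheta') => y [y' yy'].
have [x xy] : exists x, q x = y by exists (repr y); rewrite /q /orbit_map reprK.
rewrite -xy in yy'; have [W [sW Wx Wd stW]] := adapted (lifting yy').
have [oW _] := sW; have hW := chart_homeo sW; have hWi := partial_homeo_inv hW.
exists (q @` W); split.
- exact: orbit_map_open.
- by exists x.
move=> E mE EW _.
have Ed : E `<=` rdom (rinv (chart W)).
  by move=> z /EW[w Ww wz]; exists w.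
have mA := rimage_borel hWi mE.
have AW : rimage (rinv (chart W)) E `<=` W by move=> z [w _ []].
rewrite -(rimageK hWi Ed) (measure_theta sW stW Wd mA AW).
rewrite (trho _ mA); last by move=> z /AW/Wd.
by rewrite (rhomu sW)// rdom_chart.
Qed.

End Intertwine.

Lemma quotient_of_eq_borel rho rho' mu mu' :
  radon rho -> radon rho' -> radon mu -> radon mu' ->
  quotient_of rho mu -> quotient_of rho' mu' ->
  (eq_borel mu mu' <-> eq_borel rho rho').
Proof.
move=> rrho rrho' rmu rmu' rm rm'; rewrite -!transports_to_eq; split.
  apply: (transports_lift rrho rrho' rm rm' (partial_homeo_eq X) (partial_homeo_eq Y)).
  by move=> x x' ->.
apply: (transports_descend rmu rmu' rm rm' (partial_homeo_eq X) (partial_homeo_eq Y)).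
  by move=> x x' ->.
by move=> x y _; exists x.
Qed.

Lemma exists_invariant_measure (mu : borel_measure R Y) : radon mu ->
  exists2 rho : borel_measure R X, invariant_radon a rho & quotient_of rho mu.
Proof.
move=> rmu.
have [||||x|[W sW] [W' sW'] E mE EW EW'|rho rrho rhot] :=
  @glue_radon R Y X {W | section_domain W} (fun i => rinv (chart (sval i))) mu.
- exact: hY.
- exact: hX.
- exact: rmu.
- by move=> [W sW]; exact: partial_homeo_inv (chart_homeo sW).
- have [W sW Wx] := exists_section_domain x.
  by exists (exist _ W sW) => /=; exists (q x).
- rewrite /= in EW EW' *; rewrite [X in mu X](_ : _ = q @` E).
    rewrite [X in _ = mu X](_ : _ = q @` E)//.
    by apply: (@rimage_chart W') => x /EW'[y []].
  by apply: (@rimage_chart W) => x /EW[y []].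
have qrho : quotient_of rho mu.
  move=> W sW; have h := chart_homeo sW.
  exact: (transports_to_inv (partial_homeo_inv h) (rhot (exist _ W sW))).
exists rho => //; split => // U bU.
apply: (transports_lift rrho rrho qrho qrho (left_translation_homeo a bU) (partial_homeo_eq Y)).
  by move=> x x'; exact: left_translation_orbit.
exact/transports_to_eq.
Qed.

Lemma quotient_of_add rho rho' mu mu' : quotient_of rho mu ->
  quotient_of rho' mu' ->
  quotient_of (measure_add rho rho') (measure_add mu mu').
Proof.
by move=> t t' W sW A mA AW; rewrite !borel_measure_addE (t W)// (t' W).
Qed.

Lemma invariant_radon_add (rho rho' : borel_measure R X) :
  invariant_radon a rho -> invariant_radon a rho' ->
  invariant_radon a (measure_add rho rho').
Proof.
move=> [rr ir] [rr' ir']; split; first exact: radon_add.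
by move=> U bU A mA AU; rewrite !borel_measure_addE (ir U)// (ir' U).
Qed.

End Correspondence.

Theorem proposition5p11 (R : realType) (G H : etale_groupoid)
    (X : ptopologicalType) (B : bispace G H X) (hB : free_proper B) :
  exists Phi : borel_measure R X -> borel_measure R (orbit_space B),
    [/\ forall rho, invariant_radon B rho -> radon (Phi rho),
        forall rho rho', invariant_radon B rho -> invariant_radon B rho' ->
          (eq_borel (Phi rho) (Phi rho') <-> eq_borel rho rho'),
        forall mu, radon mu ->
          exists2 rho, invariant_radon B rho & eq_borel (Phi rho) mu,
        forall rho rho', invariant_radon B rho -> invariant_radon B rho' ->
          eq_borel (Phi (measure_add rho rho'))
                   (measure_add (Phi rho) (Phi rho')) &
        forall (V : set H) rho rho', open_bisection V ->
          invariant_radon B rho -> invariant_radon B rho' ->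
          (transports (right_translation (right_of B) V) rho rho' <->
           transports (right_translation (orbit_action B) V)
             (Phi rho) (Phi rho'))].
Proof.
have hX := bispace_hausdorff B; have lcX := bispace_locally_compact B.
case: hB => fa pa _ _.
have /choice[Phi PhiP] : forall rho : borel_measure R X,
    exists mu : borel_measure R (orbit_space B),
    invariant_radon B rho -> radon mu /\ quotient_of rho mu.
  move=> rho; have [irho|nrho] := pselect (invariant_radon B rho); last first.
    (* Away from invariant Radon measures any value will do. *)
    by exists mzero.
  by have [mu rmu qmu] := exists_quotient_measure hX lcX fa pa irho; exists mu.
have rPhi rho i := (PhiP rho i).1; have qPhi rho i := (PhiP rho i).2.
exists Phi; split.
- exact: rPhi.
- move=> rho rho' i i'; have [[r _] [r' _]] := (i, i').
  by apply: (quotient_of_eq_borel hX lcX fa pa) => //; auto.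
- move=> mu rmu; have [rho i qmu] := exists_invariant_measure hX lcX fa pa rmu.
  exists rho => //; have [r _] := i.
  by apply/(quotient_of_eq_borel hX lcX fa pa r r (rPhi _ i) rmu (qPhi _ i) qmu).
- move=> rho rho' i i'; have iadd := invariant_radon_add hX i i'.
  have hY := orbit_space_hausdorff hX lcX pa.
  have [r _] := iadd.
  have radd := radon_add hY (rPhi _ i) (rPhi _ i').
  have qadd := quotient_of_add (qPhi _ i) (qPhi _ i').
  by apply/(quotient_of_eq_borel hX lcX fa pa r r (rPhi _ iadd) radd (qPhi _ iadd) qadd).
- move=> V rho rho' bV i i'; have [[r _] [r' _]] := (i, i').
  have h := right_translation_homeo (right_of B) bV.
  have h' := right_translation_homeo (orbit_action B) bV.
  have semi x x' : right_translation (right_of B) V x x' ->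
      right_translation (orbit_action B) V (orbit_map B x) (orbit_map B x').
    move=> [g [Vg xg ->]]; exists g; split => //=; first by rewrite orbit_anchorE.
    by rewrite orbit_ractE.
  split.
    apply: (transports_descend hX lcX fa pa (rPhi _ i) (rPhi _ i') (qPhi _ i) (qPhi _ i') h h' semi).
    move=> x y [g [Vg xg _]]; exists (ract (right_of B) x g), g; split => //.
    by rewrite -xg /= orbit_anchorE.
  exact: (transports_lift hX lcX fa pa r r' (qPhi _ i) (qPhi _ i') h h' semi).
Qed.
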